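(* In the ground logic $\text{LD}^{\mu}_\infty$ (parameterized by a definition $\mathcal D$ meeting the requirements of $\text{LD}^{\mu}$), every derivation of a ground sequent $\Gamma\vdash C$ admits a cut-free derivation of the same sequent, i.e. a derivation of $\Gamma\vdash C$ that uses no instance of the multicut rule.
   Context: Terms, formulas and definitions: simply typed $\lambda$-terms modulo $\alpha\beta\eta$ over base types and $o$, with a signature containing $\bot,\top,\wedge,\vee,\supset$ and $\forall_\alpha,\exists_\alpha$ for first-order types $\alpha$ (types not containing $o$); atomic formulas $p\,\vec t$ with $p$ a predicate constant; a term is ground if it has no free variables. A definition $\mathcal D$ is a set of fixed-point clauses $H\stackrel{\Delta}{=}_{\mathcal X}B$ and inductive clauses $H\stackrel{\mu}{=}_{\mathcal X}B$ ($H=p\,\vec t$ a higher-order pattern containing all variables of $\mathcal X$, $B$ a formula over $\mathcal X$), each predicate being either fixed-point (only fixed-point clauses) or inductive (only inductive clauses), with $\mathrm{eq}\,X\,X\stackrel{\Delta}{=}_X\top\in\mathcal D$. Levels of ground formulas: from an ordinal assignment to ground atoms, $\mathrm{lvl}(\bot)=\mathrm{lvl}(\top)=0$, $\wedge,\vee$ take max, $\mathrm{lvl}(A\supset B)=\max(\mathrm{lvl}A+1,\mathrm{lvl}B)$, quantifiers take the supremum over ground instances. $\mathcal D$ is required to admit an assignment with $\mathrm{lvl}(H\rho)\ge\mathrm{lvl}(B\rho)$ for every clause and every grounding substitution $\rho$ for its variables, where for inductive $p$ the level of $p\,\vec t$ does not depend on $\vec t$. For an inductive $p$ with clauses $p\,\vec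 t_i\stackrel{\mu}{=}_{\mathcal X_i}B_i$, its fixed-point operator is $B=\lambda p.\lambda\vec x.\bigvee_i\exists\mathcal X_i.(\mathrm{eq}\,x_1\,t_i^1)\wedge\dots\wedge(\mathrm{eq}\,x_k\,t_i^k)\wedge B_i$. The ground logic $\text{LD}^{\mu}_\infty$: sequents $\Gamma\vdash C$ with $\Gamma$ a finite multiset of ground formulas and $C$ a ground formula. Rules: usual intuitionistic left/right rules for $\bot,\top,\wedge,\vee,\supset$; contraction, weakening; axiom $A\vdash A$ for atomic $A$; multicut (from $\Delta_i\vdash A_i$, $1\le i\le n$, and $\Gamma,A_1,\dots,A_n\vdash C$ infer $\Gamma,\Delta_1,\dots,\Delta_n\vdash C$); $\forall\mathcal L$ and $\exists\mathcal R$ instantiating with a ground term; infinitary $\forall\mathcal R$: from $\Gamma\vdash C[t/x]$ for all ground $t$ of type $\alpha$ infer $\Gamma\vdash\forall_\alpha x.C$; infinitary $\exists\mathcal L$: from $\Gamma,B[t/x]\vdash C$ for all ground $t$ infer $\Gamma,\exists_\alpha x.B\vdash C$; for $A=p\,\vec t$ with $p$ fixed-point: $\Delta\mathcal L$ infers $\Gamma,A\vdash C$ from the premises $\Gamma,B\rho\vdash C$ for every clause $H\stackrel{\Delta}{=}_{\mathcal X}B$ and substitution $\rho$ with $H\rho=A$; $\Delta\mathcal R$ infers $\Gamma\vdash A$ from $\Gamma\vdash B\rho$ for some clause and $\rho$ with $H\rho=A$; for inductive $p$ with operator $B$: $\mu\mathcal R$ infers $\Gamma\vdash p\,\vec t$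 from $\Gamma\vdash B\,p\,\vec t$; infinitary $\mu\mathcal L$: for a closed term $S$ of the type of $p$, infers $\Gamma,p\,\vec u\vdash C$ from $B\,S\,\vec t\vdash S\,\vec t$ for all ground tuples $\vec t$ and from $\Gamma,S\,\vec u\vdash C$.
   Formalization: Non-logical constants are restricted so that no formula occurs inside a term: predicates take arguments of first-order type only, other constants have first-order type; and eq X X = ⊤ is the only clause for eq. Without these restrictions cut elimination fails. *)

(* Defs.v *)
From Stdlib Require Import List Permutation Bool.
From Stdlib Require Import ClassicalEpsilon.
Import ListNotations.

Set Implicit Arguments.
Unset Strict Implicit.
Unset Printing Implicit Defensive.

(** * Ordinals

    [osup f] is the least ordinal strictly above every [f i]; ordinals are
    compared by [ole] and identified up to [oeq]. *)

Inductive ord : Type := osup (T : Type) (f : T -> ord).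

Fixpoint ole (a b : ord) {struct a} : Prop :=
  match a, b with
  | @osup T f, @osup U g => forall i : T, exists j : U, ole (f i) (g j)
  end.

Definition oeq (a b : ord) : Prop := ole a b /\ ole b a.

Definition ozero : ord := osup (fun e : Empty_set => match e with end).

Definition osucc (a : ord) : ord := osup (fun _ : unit => a).

Definition obranch (a : ord) : Type := match a with @osup T _ => T end.

Definition obelow (a : ord) : obranch a -> ord :=
  match a with @osup _ f => f end.

(* Least upper bound, not necessarily strict: an ordinal is below it exactly
   when it is below one of the [f i]. *)
Definition olub (T : Type) (f : T -> ord) : ord :=
  osup (fun x : {i : T & obranch (f i)} => obelow (projT2 x)).

Definition omax (a b : ord) : ord := olub (fun x : bool => if x then a else b).

(** * Types and signatures *)

Inductive ty (base : Type) : Type :=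
| tbase (b : base)
| to
| tarr (a b : ty base).

Arguments to {base}.

(* First-order types are those in which [to] does not occur. *)
Fixpoint firstorder (base : Type) (a : ty base) : bool :=
  match a with
  | tbase _ => true
  | to => false
  | tarr a b => firstorder a && firstorder b
  end.

Fixpoint all_fo (base : Type) (As : list (ty base)) : Prop :=
  match As with
  | [] => True
  | a :: As => firstorder a = true /\ all_fo As
  end.

(* [arrs [a1; ..; an]] is a1 -> .. -> an -> o. *)
Fixpoint arrs (base : Type) (As : list (ty base)) : ty base :=
  match As with
  | [] => to
  | a :: As => tarr a (arrs As)
  end.

(* The non-logical constants, apart from equality. A constant either has a
   first-order type or is a predicate constant with first-order arguments, so
   that no formula occurs inside a first-order term. *)
Record signature : Type := Signature {
  base : Type;
  fn : Type;
  fn_ty : fn -> ty base;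
  fn_fo : forall f : fn, firstorder (fn_ty f) = true;
  pr : Type;
  pr_args : pr -> list (ty base);
  pr_fo : forall q : pr, all_fo (pr_args q)
}.

Definition type (Sg : signature) : Type := ty (base Sg).
Definition ctx (Sg : signature) : Type := list (type Sg).

(* Predicate constants: one equality for each first-order type, and those of
   the signature. *)
Inductive pred (Sg : signature) : Type :=
| EqP (a : type Sg) (ha : firstorder a = true)
| UserP (q : pr Sg).

Arguments UserP {Sg} q.

Definition parg (Sg : signature) (p : pred Sg) : list (type Sg) :=
  match p with
  | @EqP _ a _ => [a; a]
  | UserP q => pr_args q
  end.

Definition pty (Sg : signature) (p : pred Sg) : type Sg := arrs (parg p).

Lemma parg_fo (Sg : signature) (p : pred Sg) : all_fo (parg p).
Proof. destruct p as [a ha|q]; [exact (conj ha (conj ha I))|exact (pr_fo q)]. Qed.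

(** * Simply typed terms, with typed de Bruijn variables *)

Inductive const (Sg : signature) : type Sg -> Type :=
| Bot : const to
| Top : const to
| And : const (tarr to (tarr to to))
| Or : const (tarr to (tarr to to))
| Imp : const (tarr to (tarr to to))
| All (a : type Sg) (ha : firstorder a = true) : const (tarr (tarr a to) to)
| Ex (a : type Sg) (ha : firstorder a = true) : const (tarr (tarr a to) to)
| Fn (f : fn Sg) : const (fn_ty f)
| Pred (p : pred Sg) : const (pty p).

Inductive var (Sg : signature) : ctx Sg -> type Sg -> Type :=
| vz (G : ctx Sg) (a : type Sg) : var (a :: G) a
| vs (G : ctx Sg) (a b : type Sg) (x : var G a) : var (b :: G) a.

Arguments vz {Sg G a}.

Inductive tm (Sg : signature) : ctx Sg -> type Sg -> Type :=
| Var (G : ctx Sg) (a : type Sg) (x : var G a) : tm G a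
| Con (G : ctx Sg) (a : type Sg) (c : const a) : tm G a
| App (G : ctx Sg) (a b : type Sg) (t : tm G (tarr a b)) (u : tm G a) : tm G b
| Lam (G : ctx Sg) (a b : type Sg) (t : tm (a :: G) b) : tm G (tarr a b).

Arguments Con {Sg G a} c.
Arguments Bot {Sg}.
Arguments Top {Sg}.
Arguments And {Sg}.
Arguments Or {Sg}.
Arguments Imp {Sg}.

(* Ground terms and ground formulas are closed terms. *)
Definition gtm (Sg : signature) (a : type Sg) : Type := tm [] a.
Definition gform (Sg : signature) : Type := gtm (to : type Sg).

Definition ren (Sg : signature) (G D : ctx Sg) : Type := forall a, var G a -> var D a.
Definition sub (Sg : signature) (G D : ctx Sg) : Type := forall a, var G a -> tm D a.

Definition ren_lift (Sg : signature) (G D : ctx Sg) (r : ren G D) (b : type Sg) :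
    ren (b :: G) (b :: D) := fun a x =>
  match x in var G' a' return
    match G' with
    | [] => unit
    | b' :: G0 => (forall a, var G0 a -> var D a) -> var (b' :: D) a'
    end
  with
  | vz => fun _ => vz
  | vs _ x => fun r => vs _ (r _ x)
  end r.

Fixpoint rename (Sg : signature) (G D : ctx Sg) (a : type Sg) (r : ren G D)
    (t : tm G a) {struct t} : tm D a :=
  match t in tm G a return ren G D -> tm D a with
  | Var x => fun r => Var (r _ x)
  | Con c => fun _ => Con c
  | App t u => fun r => App (rename r t) (rename r u)
  | Lam t => fun r => Lam (rename (@ren_lift _ _ _ r _) t)
  end r.

Definition shift (Sg : signature) (G : ctx Sg) (a b : type Sg) (t : tm G a) :
    tm (b :: G) a := rename (fun _ x => vs b x) t.

Definition sub_cons (Sg : signature) (G D : ctx Sg) (b : type Sg) (u : tm D b)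
    (s : sub G D) : sub (b :: G) D := fun a x =>
  match x in var G' a' return
    match G' with
    | [] => unit
    | b' :: G0 => tm D b' -> (forall a, var G0 a -> tm D a) -> tm D a'
    end
  with
  | vz => fun u _ => u
  | vs _ x => fun _ s => s _ x
  end u s.

Definition sub_lift (Sg : signature) (G D : ctx Sg) (s : sub G D) (b : type Sg) :
    sub (b :: G) (b :: D) :=
  sub_cons (Var vz) (fun a x => shift b (s a x)).

Fixpoint subst (Sg : signature) (G D : ctx Sg) (a : type Sg) (s : sub G D)
    (t : tm G a) {struct t} : tm D a :=
  match t in tm G a return sub G D -> tm D a with
  | Var x => fun s => s _ x
  | Con c => fun _ => Con c
  | App t u => fun s => App (subst s t) (subst s u)
  | Lam t => fun s => Lam (subst (@sub_lift _ _ _ s _) t)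
  end s.

(* t[u/x], where x is the last variable of the context. *)
Definition inst (Sg : signature) (G : ctx Sg) (a b : type Sg) (t : tm (b :: G) a)
    (u : tm G b) : tm G a := subst (sub_cons u (fun _ x => Var x)) t.

(* beta-eta conversion; alpha-conversion is built into the representation. *)
Inductive conv (Sg : signature) : forall (G : ctx Sg) (a : type Sg), tm G a -> tm G a -> Prop :=
| conv_refl G a (t : tm G a) : conv t t
| conv_sym G a (t u : tm G a) : conv t u -> conv u t
| conv_trans G a (t u v : tm G a) : conv t u -> conv u v -> conv t v
| conv_app G a b (t t' : tm G (tarr a b)) (u u' : tm G a) :
    conv t t' -> conv u u' -> conv (App t u) (App t' u')
| conv_lam G a b (t t' : tm (a :: G) b) : conv t t' -> conv (Lam t) (Lam t')
| conv_beta G a b (t : tm (a :: G) b) (u : tm G a) : conv (App (Lam t) u) (inst t u)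
| conv_eta G a b (t : tm G (tarr a b)) : conv t (Lam (App (shift a t) (Var vz))).

(** * Formulas *)

Definition f_bot (Sg : signature) (G : ctx Sg) : tm G to := Con Bot.
Definition f_top (Sg : signature) (G : ctx Sg) : tm G to := Con Top.
Definition f_and (Sg : signature) (G : ctx Sg) (A B : tm G to) : tm G to :=
  App (App (Con And) A) B.
Definition f_or (Sg : signature) (G : ctx Sg) (A B : tm G to) : tm G to :=
  App (App (Con Or) A) B.
Definition f_imp (Sg : signature) (G : ctx Sg) (A B : tm G to) : tm G to :=
  App (App (Con Imp) A) B.
Definition f_all (Sg : signature) (G : ctx Sg) (a : type Sg)
    (ha : firstorder a = true) (B : tm (a :: G) to) : tm G to :=
  App (Con (All ha)) (Lam B).
Definition f_ex (Sg : signature) (G : ctx Sg) (a : type Sg)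
    (ha : firstorder a = true) (B : tm (a :: G) to) : tm G to :=
  App (Con (Ex ha)) (Lam B).

Arguments f_bot {Sg G}.
Arguments f_top {Sg G}.

(* Tuples of terms of types [As]. *)
Fixpoint tms (Sg : signature) (G : ctx Sg) (As : list (type Sg)) : Type :=
  match As with
  | [] => unit
  | a :: As => (tm G a * tms G As)%type
  end.

Fixpoint tms_map (Sg : signature) (G D : ctx Sg) (f : forall a, tm G a -> tm D a)
    (As : list (type Sg)) : tms G As -> tms D As :=
  match As with
  | [] => fun _ => tt
  | a :: As => fun ts => (f a (fst ts), tms_map f (snd ts))
  end.

Fixpoint apps (Sg : signature) (G : ctx Sg) (As : list (type Sg)) :
    tm G (arrs As) -> tms G As -> tm G to :=
  match As with
  | [] => fun t _ => t
  | a :: As => fun t ts => apps (App t (fst ts)) (snd ts)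
  end.

Definition atom (Sg : signature) (G : ctx Sg) (p : pred Sg) (ts : tms G (parg p)) :
    tm G to := apps (Con (Pred p) : tm G (arrs (parg p))) ts.

Arguments atom {Sg G} p ts.

Definition f_eq (Sg : signature) (G : ctx Sg) (a : type Sg) (ha : firstorder a = true)
    (t u : tm G a) : tm G to := @atom Sg G (EqP ha) (t, (u, tt)).

(** * Higher-order patterns *)

Fixpoint var_l (Sg : signature) (G D : ctx Sg) (a : type Sg) (x : var G a) :
    var (G ++ D) a :=
  match x in var G a return var (G ++ D) a with
  | vz => vz
  | vs b x => vs b (var_l D x)
  end.

Fixpoint var_r (Sg : signature) (G D : ctx Sg) (a : type Sg) (x : var D a) :
    var (G ++ D) a :=
  match G return var (G ++ D) a with
  | [] => x
  | b :: G => vs b (var_r G x)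
  end.

(* [pattern X L t]: the term [t] over the locally bound variables [L] and the
   free variables [X] is beta-normal, and each of its occurrences of a free
   variable is applied to distinct bound variables. In [flex_spine], the list
   collects the bound variables used as arguments. *)
Inductive pattern (Sg : signature) (X : ctx Sg) :
    forall (L : ctx Sg) (a : type Sg), tm (L ++ X) a -> Prop :=
| pattern_lam L a b (t : tm (a :: L ++ X) b) :
    @pattern Sg X (a :: L) b t -> @pattern Sg X L (tarr a b) (Lam t)
| pattern_rigid L a (t : tm (L ++ X) a) : rigid_spine t -> pattern t
| pattern_flex L a (t : tm (L ++ X) a) l : flex_spine t l -> pattern t
with rigid_spine (Sg : signature) (X : ctx Sg) :
    forall (L : ctx Sg) (a : type Sg), tm (L ++ X) a -> Prop :=
| rigid_con L a (c : const a) : @rigid_spine Sg X L a (Con c)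
| rigid_var L a (x : var L a) : @rigid_spine Sg X L a (Var (var_l X x))
| rigid_app L a b (t : tm (L ++ X) (tarr a b)) (u : tm (L ++ X) a) :
    rigid_spine t -> pattern u -> rigid_spine (App t u)
with flex_spine (Sg : signature) (X : ctx Sg) :
    forall (L : ctx Sg) (a : type Sg), tm (L ++ X) a -> list {b : type Sg & var L b} -> Prop :=
| flex_var L a (x : var X a) : @flex_spine Sg X L a (Var (var_r L x)) []
| flex_app L a b (t : tm (L ++ X) (tarr a b)) (y : var L a) l :
    flex_spine t l -> ~ In (existT _ a y) l ->
    flex_spine (App t (Var (var_l X y))) (existT _ a y :: l).

Inductive occurs (Sg : signature) :
    forall (G : ctx Sg) (b a : type Sg), var G b -> tm G a -> Prop :=
| occurs_var G b (x : var G b) : occurs x (Var x)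
| occurs_appl G b c a (x : var G b) (t : tm G (tarr c a)) u :
    occurs x t -> occurs x (App t u)
| occurs_appr G b c a (x : var G b) (t : tm G (tarr c a)) u :
    occurs x u -> occurs x (App t u)
| occurs_lam G b c a (x : var G b) (t : tm (c :: G) a) :
    occurs (vs c x) t -> occurs x (Lam t).

(** * Definitions *)

(* A clause p t1 .. tk = B over the variables [cl_ctx]. These variables occur
   in the beta-normal arguments of p, hence are of first-order type. *)
Record clause (Sg : signature) (p : pred Sg) : Type := Clause {
  cl_ctx : ctx Sg;
  cl_fo : all_fo cl_ctx;
  cl_args : tms cl_ctx (parg p);
  cl_body : tm cl_ctx to;
  cl_pattern : @pattern Sg cl_ctx [] to (atom p cl_args);
  cl_occurs : forall b (x : var cl_ctx b), occurs x (atom p cl_args)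
}.

Lemma eq_clause_pattern (Sg : signature) (a : type Sg) (ha : firstorder a = true) :
  @pattern Sg [a] [] to (@f_eq Sg [a] a ha (Var vz) (Var vz)).
Proof.
  assert (@pattern Sg [a] [] a (Var vz)) as Hx.
  { apply (@pattern_flex Sg [a] [] a _ []), (@flex_var Sg [a] [] a vz). }
  apply pattern_rigid.
  apply (@rigid_app Sg [a] [] a to); [|exact Hx].
  apply (@rigid_app Sg [a] [] a (tarr a to)); [|exact Hx].
  exact (rigid_con [a] [] (Pred (EqP ha))).
Qed.


Lemma eq_clause_occurs (Sg : signature) (a : type Sg) (ha : firstorder a = true)
    b (x : var [a] b) : occurs x (@f_eq Sg [a] a ha (Var vz) (Var vz)).
Proof.
  assert (var0 : forall c, @var Sg [] c -> False).
  { intros c y.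
    exact (match y in var G _ return match G with [] => False | _ => True end
           with vz => I | vs _ _ => I end). }
  assert (var1 : forall (G : ctx Sg) c (y : var G c),
    match G return var G c -> Prop with
    | [d] => fun y => forall P : forall c, @var Sg [d] c -> Prop, P d vz -> P c y
    | _ => fun _ => True
    end y).
  { intros G c y; destruct y as [G c|G c d y]; destruct G; trivial.
    destruct (var0 _ y). }
  apply (var1 _ _ x (fun b x => occurs x (@f_eq Sg [a] a ha (Var vz) (Var vz)))).
  apply occurs_appr, occurs_var.
Qed.

(* eq X X = top *)
Definition eq_clause (Sg : signature) (a : type Sg) (ha : firstorder a = true) :
    clause (EqP ha) :=
  @Clause Sg (EqP ha) [a] (conj ha I) (Var vz, (Var vz, tt)) f_top
    (eq_clause_pattern ha) (eq_clause_occurs ha).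

(* The clauses of a predicate. An inductive predicate has finitely many of
   them, since its fixed-point operator is their disjunction. *)
Inductive pred_def (Sg : signature) (p : pred Sg) : Type :=
| FixPred (cs : clause p -> Prop)
| IndPred (cs : list (clause p)).

Definition definition (Sg : signature) : Type :=
  forall q : pr Sg, pred_def (UserP q).

(* The definition extended to equality, whose only clause is [eq_clause]. *)
Definition def_of (Sg : signature) (D : definition Sg) (p : pred Sg) : pred_def p :=
  match p with
  | EqP ha => FixPred (fun c => c = eq_clause ha)
  | UserP q => D q
  end.

Definition has_clause (Sg : signature) (D : definition Sg) (p : pred Sg)
    (c : clause p) : Prop :=
  match def_of D p with
  | FixPred cs => cs c
  | IndPred cs => In c cs
  end.

(** * Levels *)

(* [lvl] is the extension to all ground formulas, taken modulo conversion, of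
   its restriction to the ground atoms, which is arbitrary. *)
Record level_assignment (Sg : signature) (lvl : gform Sg -> ord) : Prop := {
  lvl_conv : forall A B, conv A B -> oeq (lvl A) (lvl B);
  lvl_bot : oeq (lvl f_bot) ozero;
  lvl_top : oeq (lvl f_top) ozero;
  lvl_and : forall A B, oeq (lvl (f_and A B)) (omax (lvl A) (lvl B));
  lvl_or : forall A B, oeq (lvl (f_or A B)) (omax (lvl A) (lvl B));
  lvl_imp : forall A B, oeq (lvl (f_imp A B)) (omax (osucc (lvl A)) (lvl B));
  lvl_all : forall a (ha : firstorder a = true) B,
    oeq (lvl (f_all ha B)) (olub (fun t : gtm a => lvl (inst B t)));
  lvl_ex : forall a (ha : firstorder a = true) B,
    oeq (lvl (f_ex ha B)) (olub (fun t : gtm a => lvl (inst B t)))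
}.

Definition clause_head (Sg : signature) (p : pred Sg) (c : clause p)
    (s : sub (cl_ctx c) []) : gform Sg := subst s (atom p (cl_args c)).

Definition clause_inst (Sg : signature) (p : pred Sg) (c : clause p)
    (s : sub (cl_ctx c) []) : gform Sg := subst s (cl_body c).

Definition stratified (Sg : signature) (D : definition Sg) : Prop :=
  exists lvl : gform Sg -> ord,
    level_assignment lvl /\
    (forall (p : pred Sg) (c : clause p) (s : sub (cl_ctx c) []),
        has_clause D c -> ole (lvl (clause_inst s)) (lvl (clause_head s))) /\
    (forall (p : pred Sg) cs, def_of D p = IndPred cs ->
        forall ts us : tms [] (parg p), oeq (lvl (atom p ts)) (lvl (atom p us))).

(** * Fixed-point operators *)

(* Replaces the constant [p] by [s]. *)
Fixpoint replace_pred (Sg : signature) (p : pred Sg) (G : ctx Sg) (a : type Sg)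
    (t : tm G a) : tm G (pty p) -> tm G a :=
  match t in tm G a return tm G (pty p) -> tm G a with
  | Var x => fun _ => Var x
  | @Con _ G a c => fun s =>
      match c in const a return tm G a with
      | Pred q =>
          match excluded_middle_informative (p = q) with
          | left e => eq_rect p (fun q => tm G (pty q)) s q e
          | right _ => Con (Pred q)
          end
      | c => Con c
      end
  | App t u => fun s => App (replace_pred t s) (replace_pred u s)
  | Lam t => fun s => Lam (replace_pred t (shift _ s))
  end.

(* [lams As t] binds the variables of types [As], the first one outermost. *)
Fixpoint lams (Sg : signature) (As : list (type Sg)) (G : ctx Sg) :
    tm (rev_append As G) to -> tm G (arrs As) :=
  match As with
  | [] => fun t => t
  | a :: As => fun t => Lam (@lams Sg As (a :: G) t)
  end.

Fixpoint var_under (Sg : signature) (As : list (type Sg)) (G : ctx Sg) (a : type Sg) :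
    var G a -> var (rev_append As G) a :=
  match As with
  | [] => fun x => x
  | b :: As => fun x => @var_under Sg As (b :: G) a (vs b x)
  end.

(* The variables bound by [lams As]. *)
Fixpoint lams_vars (Sg : signature) (As : list (type Sg)) (G : ctx Sg) :
    tms (rev_append As G) As :=
  match As with
  | [] => tt
  | a :: As => (Var (var_under As (vz : var (a :: G) a)), lams_vars As (a :: G))
  end.

Fixpoint exs (Sg : signature) (G X : ctx Sg) : all_fo X -> tm (X ++ G) to -> tm G to :=
  match X with
  | [] => fun _ B => B
  | a :: X => fun h B => exs (proj2 h) (f_ex (proj1 h) B)
  end.

(* eq x1 t1 /\ (.. /\ (eq xk tk /\ B)) *)
Fixpoint eqs_and (Sg : signature) (G : ctx Sg) (As : list (type Sg)) :
    all_fo As -> tms G As -> tms G As -> tm G to -> tm G to :=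
  match As with
  | [] => fun _ _ _ B => B
  | a :: As => fun h xs ts B =>
      f_and (f_eq (proj1 h) (fst xs) (fst ts)) (eqs_and (proj2 h) (snd xs) (snd ts) B)
  end.

Fixpoint disj (Sg : signature) (G : ctx Sg) (Bs : list (tm G to)) : tm G to :=
  match Bs with
  | [] => f_bot
  | [B] => B
  | B :: Bs => f_or B (disj Bs)
  end.

(* The disjunct of a clause, over the abstracted predicate and its arguments. *)
Definition clause_disjunct (Sg : signature) (p : pred Sg) (c : clause p) :
    tm (rev_append (parg p) [pty p]) to :=
  let X := cl_ctx c in
  let G := rev_append (parg p) [pty p] in
  let xs := tms_map (fun a => rename (fun b x => var_r X x)) (lams_vars (parg p) [pty p]) in
  let ts := tms_map (fun a => rename (fun b x => var_l G x)) (cl_args c) in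
  let P := Var (var_r X (var_under (parg p) (vz : var [pty p] (pty p)))) in
  exs (cl_fo c)
    (eqs_and (parg_fo p) xs ts
       (replace_pred (p := p) (rename (fun b x => var_l G x) (cl_body c)) P)).

Definition fix_op (Sg : signature) (p : pred Sg) (cs : list (clause p)) :
    gtm (tarr (pty p) (pty p)) :=
  Lam (@lams Sg (parg p) [pty p] (disj (map (@clause_disjunct Sg p) cs))).

(** * The ground logic *)

Definition gapps (Sg : signature) (p : pred Sg) (S : gtm (pty p))
    (ts : tms [] (parg p)) : gform Sg := apps (S : tm [] (arrs (parg p))) ts.

(* Equality of finite multisets of formulas modulo conversion. *)
Definition same_context (Sg : signature) (G G' : list (gform Sg)) : Prop :=
  exists G'', Permutation G G'' /\ Forall2 (@conv Sg [] to) G'' G'.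

(* Derivability; multicut is available only when [cuts] is [true], so that
   [derivable D false] is derivability without cut. [d_same] only changes the
   representation of a sequent. *)
Inductive derivable (Sg : signature) (D : definition Sg) (cuts : bool) :
    list (gform Sg) -> gform Sg -> Prop :=
| d_same G G' C C' :
    same_context G G' -> conv C C' -> derivable D cuts G C -> derivable D cuts G' C'
| d_axiom p ts : derivable D cuts [atom p ts] (atom p ts)
| d_multicut G (cs : list (list (gform Sg) * gform Sg)) C :
    cuts = true ->
    (forall DA, In DA cs -> derivable D cuts (fst DA) (snd DA)) ->
    derivable D cuts (G ++ map snd cs) C ->
    derivable D cuts (G ++ concat (map fst cs)) C
| d_weakening G A C : derivable D cuts G C -> derivable D cuts (A :: G) C
| d_contraction G A C : derivable D cuts (A :: A :: G) C -> derivable D cuts (A :: G) C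
| d_botL G C : derivable D cuts (f_bot :: G) C
| d_topR G : derivable D cuts G f_top
| d_andL1 G A B C : derivable D cuts (A :: G) C -> derivable D cuts (f_and A B :: G) C
| d_andL2 G A B C : derivable D cuts (B :: G) C -> derivable D cuts (f_and A B :: G) C
| d_andR G A B :
    derivable D cuts G A -> derivable D cuts G B -> derivable D cuts G (f_and A B)
| d_orL G A B C :
    derivable D cuts (A :: G) C -> derivable D cuts (B :: G) C ->
    derivable D cuts (f_or A B :: G) C
| d_orR1 G A B : derivable D cuts G A -> derivable D cuts G (f_or A B)
| d_orR2 G A B : derivable D cuts G B -> derivable D cuts G (f_or A B)
| d_impL G A B C :
    derivable D cuts G A -> derivable D cuts (B :: G) C ->
    derivable D cuts (f_imp A B :: G) C
| d_impR G A B : derivable D cuts (A :: G) B -> derivable D cuts G (f_imp A B)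
| d_allL G a (ha : firstorder a = true) B (t : gtm a) C :
    derivable D cuts (inst B t :: G) C -> derivable D cuts (f_all ha B :: G) C
| d_allR G a (ha : firstorder a = true) B :
    (forall t : gtm a, derivable D cuts G (inst B t)) -> derivable D cuts G (f_all ha B)
| d_exL G a (ha : firstorder a = true) B C :
    (forall t : gtm a, derivable D cuts (inst B t :: G) C) ->
    derivable D cuts (f_ex ha B :: G) C
| d_exR G a (ha : firstorder a = true) B (t : gtm a) :
    derivable D cuts G (inst B t) -> derivable D cuts G (f_ex ha B)
| d_defL G p cs (ts : tms [] (parg p)) C :
    def_of D p = FixPred cs ->
    (forall (c : clause p) (s : sub (cl_ctx c) []),
        cs c -> conv (clause_head s) (atom p ts) ->
        derivable D cuts (clause_inst s :: G) C) ->
    derivable D cuts (atom p ts :: G) C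
| d_defR G p cs (ts : tms [] (parg p)) (c : clause p) (s : sub (cl_ctx c) []) :
    def_of D p = FixPred cs ->
    cs c -> conv (clause_head s) (atom p ts) ->
    derivable D cuts G (clause_inst s) ->
    derivable D cuts G (atom p ts)
| d_muL G p cs (S : gtm (pty p)) (us : tms [] (parg p)) C :
    def_of D p = IndPred cs ->
    (forall ts : tms [] (parg p),
        derivable D cuts [gapps (App (fix_op cs) S) ts] (gapps S ts)) ->
    derivable D cuts (gapps S us :: G) C ->
    derivable D cuts (atom p us :: G) C
| d_muR G p cs (ts : tms [] (parg p)) :
    def_of D p = IndPred cs ->
    derivable D cuts G (gapps (App (fix_op cs) (Con (Pred p))) ts) ->
    derivable D cuts G (atom p ts).

(* Main.v *)
(** A semantic cut elimination in the style of Okada. A formula is interpreted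
    by a set of contexts closed under the rules of the cut-free calculus ("fact");
    every A is interpreted by an X with [A] in X and with all members of X proving
    A without cut, so soundness of the full calculus, applied to the context G of
    a derivable sequent, yields a cut-free proof. Atoms are interpreted level by
    level, those of one level simultaneously, by the least valuation that contains
    each [A] and is a prefixed point of the clauses; this exists since negative
    occurrences have smaller level. An atom p u with p inductive always lies in the
    interpretation of S u when S is an invariant, because adequacy turns the
    semantic inclusion of B S t in S t into a cut-free proof of the premise of the
    induction rule. Hence the interpretation of S is a competitor of the least
    fixed point, and no syntactic functoriality of B is required. *)

Require Import Defs.
From Stdlib Require Import List Permutation Bool.
From Stdlib Require Import ClassicalEpsilon FunctionalExtensionality PropExtensionality.
Import ListNotations.

Set Implicit Arguments.
Unset Strict Implicit.
Unset Printing Implicit Defensive.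

(** * Substitution *)

Section Substitution.
Context {Sg : signature}.
Implicit Types G D E : ctx Sg.

(** The induction rule puts an arbitrary closed [S] for [p] into bodies that are terms modulo
    conversion, so [B S t] has no fixed shape to argue on. Terms of all types are therefore
    interpreted, and [rrel_eval] shows that replacing [p] by [S] in the syntax amounts to
    reinterpreting [p] in the valuation. For this, first-order terms must be blind to the
    replacement, although [p] may hide in parts of them that reduction erases. A least valuation
    gives prefixed points, which serve the right rules. For a fixed-point predicate the left rule
    also asks for postfixed points; they exist because [d_defL] puts [[A]] into the unfolding of
    [A], so that shrinking to the unfolding keeps [[A]]. Inductive predicates have no such rule and
    get an induction principle instead. It changes [p] at all arguments at once, which leaves
    smaller levels intact because the level of an inductive atom ignores its arguments. Fixed-point
    operators mention equality, so the valuation that bounds the candidates must read it as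
    conversion at every level. *)

Lemma var_nil (a : type Sg) : var [] a -> False.
Proof.
  intros x.
  exact (match x in var G _ return match G with [] => False | _ => True end
         with vz => I | vs _ _ => I end).
Qed.

(** Meant for use after [pattern]. [P] is generalised inside the match because the index [b :: G] is
    not a variable. *)
Lemma var_cons_case G b (P : forall a, var (b :: G) a -> Prop) :
  P b vz -> (forall a (x : var G a), P a (vs b x)) -> forall a x, P a x.
Proof.
  intros Hz Hs a x.
  refine (match x as x' in var G' a' return
    match G' return var G' a' -> Prop with
    | [] => fun _ => True
    | b' :: G0 => fun x' => forall P : forall a, var (b' :: G0) a -> Prop,
       P b' vz -> (forall a (x : var G0 a), P a (vs b' x)) -> P a' x'
    end x' with vz => _ | vs _ _ => _ end P Hz Hs).
  - intros P' H _; exact H.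
  - intros P' _ H; apply H.
Qed.

Lemma fun_var_ext G (F : type Sg -> Type) (f g : forall a, var G a -> F a) :
  (forall a x, f a x = g a x) -> f = g.
Proof.
  intros H; apply functional_extensionality_dep; intros a.
  apply functional_extensionality; intros x; apply H.
Qed.

Lemma ren_lift_comp G D E (r : ren G D) (q : ren D E) (b : type Sg) :
  (fun a x => @ren_lift _ _ _ q b a (@ren_lift _ _ _ r b a x)) =
  @ren_lift _ _ _ (fun a x => q a (r a x)) b.
Proof. apply fun_var_ext; intros a x; pattern a, x; apply var_cons_case; reflexivity. Qed.

Lemma rename_rename G a (t : tm G a) : forall D E (r : ren G D) (q : ren D E),
  rename q (rename r t) = rename (fun a x => q a (r a x)) t.
Proof.
  induction t; intros; simpl; f_equal; auto.
  rewrite IHt, ren_lift_comp; reflexivity.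
Qed.

Lemma sub_lift_ren G D E (r : ren G D) (s : sub D E) (b : type Sg) :
  (fun a x => @sub_lift _ _ _ s b a (@ren_lift _ _ _ r b a x)) =
  @sub_lift _ _ _ (fun a x => s a (r a x)) b.
Proof. apply fun_var_ext; intros a x; pattern a, x; apply var_cons_case; reflexivity. Qed.

Lemma subst_rename G a (t : tm G a) : forall D E (r : ren G D) (s : sub D E),
  subst s (rename r t) = subst (fun a x => s a (r a x)) t.
Proof.
  induction t; intros; simpl; f_equal; auto.
  rewrite IHt, sub_lift_ren; reflexivity.
Qed.

Lemma ren_lift_sub G D E (s : sub G D) (r : ren D E) (b : type Sg) :
  (fun a x => rename (@ren_lift _ _ _ r b) (@sub_lift _ _ _ s b a x)) =
  @sub_lift _ _ _ (fun a x => rename r (s a x)) b.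
Proof.
  apply fun_var_ext; intros a x; pattern a, x; apply var_cons_case; [reflexivity|].
  intros a' x'; unfold sub_lift; cbn; unfold shift; rewrite !rename_rename; reflexivity.
Qed.

Lemma rename_subst G a (t : tm G a) : forall D E (s : sub G D) (r : ren D E),
  rename r (subst s t) = subst (fun a x => rename r (s a x)) t.
Proof.
  induction t; intros; simpl; f_equal; auto.
  rewrite IHt, ren_lift_sub; reflexivity.
Qed.

(** [sub_lift] shifts by a renaming, so composing two substitutions under a binder rests on both
    mixed composition laws. *)
Lemma sub_lift_sub G D E (s : sub G D) (q : sub D E) (b : type Sg) :
  (fun a x => subst (@sub_lift _ _ _ q b) (@sub_lift _ _ _ s b a x)) =
  @sub_lift _ _ _ (fun a x => subst q (s a x)) b.
Proof.
  apply fun_var_ext; intros a x; pattern a, x; apply var_cons_case; [reflexivity|].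
  intros a' x'; unfold sub_lift; cbn; unfold shift.
  rewrite subst_rename, rename_subst; reflexivity.
Qed.

Lemma subst_subst G a (t : tm G a) : forall D E (s : sub G D) (q : sub D E),
  subst q (subst s t) = subst (fun a x => subst q (s a x)) t.
Proof.
  induction t; intros; simpl; f_equal; auto.
  rewrite IHt, sub_lift_sub; reflexivity.
Qed.

Lemma subst_var G a (t : tm G a) : subst (fun a x => Var x) t = t.
Proof.
  induction t; simpl; f_equal; auto.
  rewrite <- IHt at 2; f_equal.
  apply fun_var_ext; intros a' x; pattern a', x; apply var_cons_case; reflexivity.
Qed.

Lemma rename_as_subst G D a (r : ren G D) (t : tm G a) :
  rename r t = subst (fun a x => Var (r a x)) t.
Proof. rewrite <- (subst_var t) at 1; rewrite rename_subst; reflexivity. Qed.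

Lemma rename_id G a (t : tm G a) : rename (fun a x => x) t = t.
Proof. rewrite rename_as_subst; apply subst_var. Qed.

Lemma subst_closed a (t : gtm a) (s : sub (Sg := Sg) [] []) : subst s t = t.
Proof.
  rewrite <- (subst_var t) at 2; f_equal.
  apply fun_var_ext; intros b x; destruct (var_nil x).
Qed.

Lemma subst_shift G D a b (t : tm G a) (u : tm D b) (s : sub G D) :
  subst (sub_cons u s) (shift b t) = subst s t.
Proof. unfold shift; rewrite subst_rename; reflexivity. Qed.

Lemma inst_lift G D a b (t : tm (b :: G) a) (s : sub G D) (u : tm D b) :
  inst (subst (@sub_lift _ _ _ s b) t) u = subst (sub_cons u s) t.
Proof.
  unfold inst; rewrite subst_subst; f_equal.
  apply fun_var_ext; intros a' x; pattern a', x; apply var_cons_case; [reflexivity|].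
  intros a'' x'; unfold sub_lift; cbn; rewrite subst_shift; apply subst_var.
Qed.

Lemma subst_inst G D a b (t : tm (b :: G) a) (u : tm G b) (s : sub G D) :
  subst s (inst t u) = subst (sub_cons (subst s u) s) t.
Proof.
  unfold inst; rewrite subst_subst; f_equal.
  apply fun_var_ext; intros a' x; pattern a', x; apply var_cons_case; reflexivity.
Qed.

Lemma subst_inst_lift G D a b (t : tm (b :: G) a) (u : tm G b) (s : sub G D) :
  subst s (inst t u) = inst (subst (@sub_lift _ _ _ s b) t) (subst s u).
Proof. rewrite inst_lift; apply subst_inst. Qed.

Lemma subst_shift_lift G D a b (t : tm G a) (s : sub G D) :
  subst (@sub_lift _ _ _ s b) (shift b t) = shift b (subst s t).
Proof. unfold shift; rewrite subst_rename, rename_subst; reflexivity. Qed.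

(** * Conversion under substitution and renaming *)

Lemma conv_subst G a (t t' : tm G a) : conv t t' ->
  forall D (s : sub G D), conv (subst s t) (subst s t').
Proof.
  induction 1; intros D s; simpl.
  - apply conv_refl.
  - apply conv_sym; auto.
  - eapply conv_trans; eauto.
  - apply conv_app; auto.
  - apply conv_lam; auto.
  - rewrite subst_inst_lift; apply conv_beta.
  - rewrite subst_shift_lift; apply conv_eta.
Qed.

Lemma conv_rename G D a (t t' : tm G a) (r : ren G D) :
  conv t t' -> conv (rename r t) (rename r t').
Proof. intros H; rewrite !rename_as_subst; apply conv_subst, H. Qed.

Lemma conv_sub_ext G a (t : tm G a) : forall D (s s' : sub G D),
  (forall b x, conv (s b x) (s' b x)) -> conv (subst s t) (subst s' t).
Proof.
  induction t; intros D s s' H; simpl.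
  - apply H.
  - apply conv_refl.
  - apply conv_app; auto.
  - apply conv_lam, IHt.
    intros c x; pattern c, x; apply var_cons_case; [apply conv_refl|].
    intros c' x'; unfold sub_lift; cbn; apply conv_rename, H.
Qed.

Lemma conv_beta_lift G D a b (t : tm (b :: G) a) (s : sub G D) (u : tm D b) :
  conv (App (subst s (Lam t)) u) (subst (sub_cons u s) t).
Proof. rewrite <- inst_lift; apply conv_beta. Qed.

(** * Replacement of a predicate constant *)

Lemma rename_replace (p : pred Sg) G a (t : tm G a) :
  forall D (r : ren G D) (P : tm G (pty p)),
  rename r (replace_pred t P) = replace_pred (rename r t) (rename r P).
Proof.
  induction t; intros D r P; simpl; f_equal; auto.
  - destruct c; try reflexivity.
    destruct (excluded_middle_informative (p = p0)) as [e|n]; [|reflexivity].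
    destruct e; reflexivity.
  - rewrite IHt; f_equal.
    unfold shift; rewrite !rename_rename; reflexivity.
Qed.

Lemma replace_Pred (p : pred Sg) G (P : tm G (pty p)) :
  replace_pred (Con (Pred p)) P = P.
Proof.
  simpl; destruct (excluded_middle_informative (p = p)) as [e|n]; [|destruct n; reflexivity].
  rewrite (proof_irrelevance _ e eq_refl); reflexivity.
Qed.

(** The substitutions differ on the two sides because replacement also acts inside the terms
    substituted on the right. With [P] open, this covers both a beta step and the instantiation of a
    variable that stands for the predicate. *)
Lemma conv_subst_replace (p : pred Sg) G a (t : tm G a) :
  forall D (P : tm G (pty p)) (Q : tm D (pty p)) (s s' : sub G D),
  conv (subst s P) Q ->
  (forall b x, conv (s b x) (replace_pred (s' b x) Q)) ->
  conv (subst s (replace_pred t P)) (replace_pred (subst s' t) Q).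
Proof.
  induction t; intros D P Q s s' HP Hs; simpl.
  - apply Hs.
  - destruct c; try apply conv_refl.
    destruct (excluded_middle_informative (p = p0)) as [e|n]; [|apply conv_refl].
    destruct e; exact HP.
  - apply conv_app; auto.
  - apply conv_lam, IHt.
    + rewrite subst_shift_lift; apply conv_rename, HP.
    + intros c x; pattern c, x; apply var_cons_case; [apply conv_refl|].
      intros c' x'; unfold sub_lift; cbn; unfold shift.
      rewrite <- rename_replace; apply conv_rename, Hs.
Qed.

Lemma conv_replace (p : pred Sg) G a (t t' : tm G a) : conv t t' ->
  forall Q : tm G (pty p), conv (replace_pred t Q) (replace_pred t' Q).
Proof.
  induction 1; intros Q; simpl.
  - apply conv_refl.
  - apply conv_sym; auto.
  - eapply conv_trans; eauto.
  - apply conv_app; auto.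
  - apply conv_lam; auto.
  - eapply conv_trans; [apply conv_beta|].
    apply conv_subst_replace; [rewrite subst_shift, subst_var; apply conv_refl|].
    intros c x; pattern c, x; apply var_cons_case; intros; apply conv_refl.
  - unfold shift; rewrite <- rename_replace; apply conv_eta.
Qed.

(** Renamings are built in because a term of function type is tested on a fresh variable, and the
    replacing term then lives in the extended context. *)
Definition insensitive (p : pred Sg) G a (t : tm G a) : Prop :=
  forall D (r : ren G D) (Q : tm D (pty p)), conv (replace_pred (rename r t) Q) (rename r t).

(* Kripke logical predicate over all contexts. At type [to] nothing is required,
   since predicates are hidden only in the arguments of redexes. *)
Fixpoint kripke (p : pred Sg) (a : type Sg) : forall G, tm G a -> Prop :=
  match a with
  | tbase _ => fun G t => insensitive p t
  | to => fun _ _ => True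
  | tarr a b => fun G t => forall D (r : ren G D) (u : tm D a),
      kripke p u -> kripke p (App (rename r t) u)
  end.

Lemma insensitive_rename (p : pred Sg) G a (t : tm G a) D (r : ren G D) :
  insensitive p t -> insensitive p (rename r t).
Proof. intros H E q Q; rewrite rename_rename; apply H. Qed.

Lemma insensitive_conv (p : pred Sg) G a (t t' : tm G a) :
  conv t t' -> insensitive p t -> insensitive p t'.
Proof.
  intros Hc H D r Q.
  pose proof (conv_rename r Hc) as Hr.
  eapply conv_trans; [apply conv_replace, conv_sym, Hr|].
  eapply conv_trans; [apply H|exact Hr].
Qed.

Lemma kripke_rename (p : pred Sg) a : forall G (t : tm G a) D (r : ren G D),
  kripke p t -> kripke p (rename r t).
Proof.
  destruct a; intros G t D r H; simpl in *.
  - apply insensitive_rename, H.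
  - exact I.
  - intros E q u Hu; rewrite rename_rename; apply H, Hu.
Qed.

Lemma kripke_conv (p : pred Sg) a : forall G (t t' : tm G a),
  conv t t' -> kripke p t -> kripke p t'.
Proof.
  induction a; intros G t t' Hc H; simpl in *.
  - eapply insensitive_conv; eassumption.
  - exact I.
  - intros D r u Hu; eapply IHa2; [|apply H, Hu].
    apply conv_app; [apply conv_rename, Hc|apply conv_refl].
Qed.

(** Reification and reflection at once: a function is recovered from its value at a fresh variable
    by eta, and conversely insensitivity is inherited by applications. *)
Lemma kripke_firstorder (p : pred Sg) a : firstorder a = true -> forall G (t : tm G a),
  kripke p t <-> insensitive p t.
Proof.
  induction a; intros Ha G t; simpl in *; [reflexivity|discriminate|].
  apply andb_true_iff in Ha as [H1 H2]; split; intros H.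
  - intros D r Q.
    eapply conv_trans; [apply conv_eta|].
    eapply conv_trans; [|apply conv_sym, conv_eta].
    apply conv_lam.
    (* The fresh variable is insensitive, hence by reflection in the predicate at [a1]. *)
    assert (kripke p (App (rename (fun b x => vs a1 (r b x)) t) (Var (vz : var (a1 :: D) a1)))) as K.
    { apply H, IHa1; [exact H1|]. intros E q Q'; apply conv_refl. }
    apply (IHa2 H2) in K.
    specialize (K _ (fun a x => x) (shift a1 Q)).
    rewrite rename_id in K; simpl in K.
    unfold shift; rewrite rename_replace, !rename_rename; exact K.
  - intros D r u Hu; apply (IHa2 H2).
    apply (IHa1 H1) in Hu.
    intros E q Q; simpl; apply conv_app; [rewrite rename_rename; apply H|apply Hu].
Qed.

(** This admits every predicate constant, [p] included, in the fundamental lemma: the target type is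
    [to], where the predicate is trivial. *)
Lemma kripke_arrs (p : pred Sg) (As : list (type Sg)) : forall G (t : tm G (arrs As)), kripke p t.
Proof. induction As; simpl; auto. Qed.

Lemma kripke_subst (p : pred Sg) G a (t : tm G a) : forall D (s : sub G D),
  (forall b x, kripke p (s b x)) -> kripke p (subst s t).
Proof.
  induction t; intros D s Hs.
  - apply Hs.
  - destruct c; try (simpl; auto; fail).
    + apply kripke_firstorder; [apply fn_fo|]. intros E q Q; apply conv_refl.
    + apply (@kripke_arrs p (parg p0)).
  - simpl subst.
    pose proof (IHt1 _ _ Hs _ (fun a x => x) _ (IHt2 _ _ Hs)) as H.
    rewrite rename_id in H; exact H.
  - intros E r u Hu.
    rewrite rename_subst.
    eapply kripke_conv; [apply conv_sym, conv_beta_lift|].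
    apply IHt; intros c x; pattern c, x; apply var_cons_case; [exact Hu|].
    intros c' x'; apply kripke_rename, Hs.
Qed.

(** The fundamental lemma for the identity substitution of a closed term, followed by
    reification. *)
Lemma conv_replace_firstorder (p : pred Sg) a (ha : firstorder a = true) (t : gtm a)
    (S : gtm (pty p)) : conv (replace_pred t S) t.
Proof.
  assert (kripke p (subst (fun a x => Var x) t)) as K.
  { apply kripke_subst; intros b x; destruct (var_nil x). }
  rewrite subst_var in K; apply kripke_firstorder in K; [|exact ha].
  specialize (K _ (fun a x => x) S); rewrite rename_id in K; exact K.
Qed.

(** * Ground formulas *)

(** Takes the place of normal forms: it allows induction on ground formulas modulo conversion, with
    all ground instances as premises at a quantifier. *)
Inductive formula : gform Sg -> Prop :=
| formula_conv A B : conv A B -> formula A -> formula B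
| formula_bot : formula f_bot
| formula_top : formula f_top
| formula_and A B : formula A -> formula B -> formula (f_and A B)
| formula_or A B : formula A -> formula B -> formula (f_or A B)
| formula_imp A B : formula A -> formula B -> formula (f_imp A B)
| formula_all a (ha : firstorder a = true) B :
    (forall t : gtm a, formula (inst B t)) -> formula (f_all ha B)
| formula_ex a (ha : firstorder a = true) B :
    (forall t : gtm a, formula (inst B t)) -> formula (f_ex ha B)
| formula_atom p ts : formula (atom p ts).

(** Logical predicate for [gform_formula]. Base types carry no condition, since atoms accept
    arbitrary argument terms. *)
Fixpoint formula_rel (a : type Sg) : gtm a -> Prop :=
  match a with
  | tbase _ => fun _ => True
  | to => fun A => formula A
  | tarr a b => fun t => forall u : gtm a, formula_rel u -> formula_rel (App t u)
  end.

Lemma formula_rel_conv a : forall t t' : gtm a, conv t t' -> formula_rel t -> formula_rel t'.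
Proof.
  induction a; simpl; intros t t' Hc H; auto.
  - eapply formula_conv; eassumption.
  - intros u Hu; eapply IHa2; [|apply H, Hu]. apply conv_app; [exact Hc|apply conv_refl].
Qed.

Lemma formula_rel_firstorder a : firstorder a = true -> forall t : gtm a, formula_rel t.
Proof.
  induction a; simpl; intros Ha t; auto; [discriminate|].
  apply andb_true_iff in Ha as [H1 H2]; auto.
Qed.

Lemma formula_rel_arrs (As : list (type Sg)) : forall t : gtm (arrs As),
  (forall ts : tms [] As, formula (apps t ts)) -> formula_rel t.
Proof.
  induction As as [|a As IH]; simpl; intros t H.
  - exact (H tt).
  - intros u _; apply IH; intros ts; exact (H (u, ts)).
Qed.

Lemma formula_rel_subst G a (t : tm G a) : forall s : sub G [],
  (forall b x, formula_rel (s b x)) -> formula_rel (subst s t).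
Proof.
  induction t; intros s Hs.
  - apply Hs.
  (* A quantifier may be applied to any term [g], not only to an abstraction; after eta expansion
     its instances reduce to [App g t]. *)
  - assert (forall b (g : gtm (tarr b to)), formula_rel g ->
      firstorder b = true -> forall t, formula (inst (App (shift b g) (Var vz)) t)) as Hq.
    { intros b g Hg Hb t; unfold inst; simpl; rewrite subst_shift, subst_var.
      apply Hg, formula_rel_firstorder, Hb. }
    destruct c; simpl.
    + apply formula_bot.
    + apply formula_top.
    + intros; apply formula_and; auto.
    + intros; apply formula_or; auto.
    + intros; apply formula_imp; auto.
    + intros g Hg; eapply formula_conv; [apply conv_app; [apply conv_refl|apply conv_sym, conv_eta]|].
      apply formula_all, Hq; auto.
    + intros g Hg; eapply formula_conv; [apply conv_app; [apply conv_refl|apply conv_sym, conv_eta]|].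
      apply formula_ex, Hq; auto.
    + apply formula_rel_firstorder, fn_fo.
    + apply (@formula_rel_arrs (parg p)), formula_atom.
  - exact (IHt1 _ Hs _ (IHt2 _ Hs)).
  - intros u Hu; eapply formula_rel_conv; [apply conv_sym, conv_beta_lift|].
    apply IHt; intros c x; pattern c, x; apply var_cons_case; [exact Hu|intros; apply Hs].
Qed.

Lemma gform_formula (A : gform Sg) : formula A.
Proof.
  rewrite <- (subst_var A); apply (@formula_rel_subst [] to).
  intros b x; destruct (var_nil x).
Qed.

End Substitution.
(** * Ordinals *)

Definition olt (a b : ord) : Prop := ole (osucc a) b.

Lemma olt_osup (a : ord) T (f : T -> ord) : olt a (osup f) <-> exists i, ole a (f i).
Proof. split; [intros H; exact (H tt)|intros H i; exact H]. Qed.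

Lemma ole_refl (a : ord) : ole a a.
Proof. induction a as [T f IH]; intros i; exists i; apply IH. Qed.

Lemma ole_trans (a : ord) : forall b c, ole a b -> ole b c -> ole a c.
Proof.
  induction a as [T f IH]; intros [U g] [W h] H1 H2 i.
  destruct (H1 i) as [j Hj], (H2 j) as [k Hk]; exists k; eauto.
Qed.

Lemma ole_osucc (a : ord) : ole a (osucc a).
Proof.
  induction a as [T f IH]; intros i; exists tt.
  assert (forall b, ole b (osucc b) -> ole b (f i) -> ole b (osup f)) as H.
  { intros [U g] H H' j; destruct (H j) as [[] Hj]; exists i; exact (ole_trans Hj H'). }
  apply H; [apply IH|apply ole_refl].
Qed.

Lemma olt_ole_trans (a b c : ord) : olt a b -> ole b c -> olt a c.
Proof. apply ole_trans. Qed.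

Lemma ole_olt_trans (a b c : ord) : ole a b -> olt b c -> olt a c.
Proof.
  destruct c as [W h]; rewrite !olt_osup; intros H [i Hi]; exists i; eapply ole_trans; eassumption.
Qed.

(** Classical. If [b] is below no branch of [a], then each branch of [a] is below some branch of
    [b]: otherwise, by induction, all branches of [b] would lie strictly below that branch of [a],
    and so [b] would be below it. *)
Lemma ole_or_olt (a : ord) : forall b, ole a b \/ olt b a.
Proof.
  induction a as [T f IH]; intros [U g].
  destruct (excluded_middle_informative (exists i, ole (osup g) (f i))) as [H|H].
  - right; apply olt_osup, H.
  - left; intros i; destruct (excluded_middle_informative (exists j, ole (f i) (g j))) as [H'|H'];
      [exact H'|].
    destruct H; exists i; specialize (IH i); destruct (f i) as [V k]; intros j.
    destruct (IH (g j)) as [H1|H1]; [destruct H'; exists j; exact H1|].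
    exact (H1 tt).
Qed.

Lemma olt_wf : well_founded olt.
Proof.
  (* Ordinals are identified only up to [oeq], so accessibility is proved for everything below [a]
     and not for the term [a] alone. *)
  assert (forall a b, ole b a -> Acc olt b) as H; [|intros a; exact (H a a (ole_refl a))].
  induction a as [T f IH]; intros b Hb; constructor; intros c Hc.
  pose proof (olt_ole_trans Hc Hb) as H; destruct (H tt) as [i Hi]; exact (IH i c Hi).
Qed.

Lemma ole_osucc_ole (a b : ord) : olt a b -> ole a b.
Proof. intros H; eapply ole_trans; [apply ole_osucc|exact H]. Qed.

Lemma olt_irrefl (a : ord) : ~ olt a a.
Proof. induction (olt_wf a) as [a _ IH]; intros H; exact (IH a H H). Qed.

Lemma ole_olub T (f : T -> ord) i : ole (f i) (olub f).
Proof.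
  assert (forall a b, (forall k : obranch a, olt (obelow k) b) -> ole a b) as H.
  { intros [U g] [W h] H k; exact (H k tt). }
  apply H; intros k _.
  exists (existT (fun i => obranch (f i)) i k); apply ole_refl.
Qed.

Lemma ole_omax_l (a b : ord) : ole a (omax a b).
Proof. exact (ole_olub (fun x : bool => if x then a else b) true). Qed.

Lemma ole_omax_r (a b : ord) : ole b (omax a b).
Proof. exact (ole_olub (fun x : bool => if x then a else b) false). Qed.

(** * Facts *)

Section Facts.
Context {Sg : signature} (D : definition Sg).

Definition fact : Type := list (gform Sg) -> Prop.

Notation "G |- C" := (derivable D false G C) (at level 70).

Definition le (X Y : fact) : Prop := forall G, X G -> Y G.

(** Biorthogonal closure, for the orthogonality between a context [G] and a pair [(E, C)] given by
    cut-free provability of [G ++ E |- C]. *)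
Definition cl (Z : fact) : fact := fun G =>
  forall E C, (forall G', Z G' -> G' ++ E |- C) -> G ++ E |- C.

Definition closed (X : fact) : Prop := le (cl X) X.

(** Monotonicity along [incl] expresses weakening, contraction and exchange together. *)
Definition upward (X : fact) : Prop := forall G G', incl G G' -> X G -> X G'.

Definition provable (A : gform Sg) : fact := fun G => G |- A.

Lemma fact_ext (X Y : fact) : le X Y -> le Y X -> X = Y.
Proof.
  intros H1 H2; apply functional_extensionality; intros G; apply propositional_extensionality.
  split; auto.
Qed.

(** * Structural rules in the form of list inclusion *)

Lemma Forall2_refl A (R : A -> A -> Prop) (l : list A) : (forall x, R x x) -> Forall2 R l l.
Proof. induction l; constructor; auto. Qed.

Lemma derivable_perm cuts G G' C :
  Permutation G G' -> derivable D cuts G C -> derivable D cuts G' C.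
Proof.
  intros HP; apply d_same; [|apply conv_refl].
  exists G'; split; [exact HP|apply Forall2_refl; intros; apply conv_refl].
Qed.

Lemma derivable_conv cuts G C C' : conv C C' -> derivable D cuts G C -> derivable D cuts G C'.
Proof.
  intros HC; apply d_same; [|exact HC].
  exists G; split; [apply Permutation_refl|apply Forall2_refl; intros; apply conv_refl].
Qed.

Lemma derivable_conv_hyp cuts A A' G C :
  conv A A' -> derivable D cuts (A :: G) C -> derivable D cuts (A' :: G) C.
Proof.
  intros HC; apply d_same; [|apply conv_refl].
  exists (A :: G); split; [apply Permutation_refl|constructor; [exact HC|]].
  apply Forall2_refl; intros; apply conv_refl.
Qed.

Lemma derivable_app cuts G E C : derivable D cuts G C -> derivable D cuts (E ++ G) C.
Proof. intros H; induction E; simpl; [exact H|apply d_weakening; assumption]. Qed.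

Lemma derivable_absorb cuts G : forall E C,
  incl G E -> derivable D cuts (G ++ E) C -> derivable D cuts E C.
Proof.
  induction G as [|A G IH]; intros E C Hi H; [exact H|].
  apply IH; [intros x Hx; apply Hi; right; exact Hx|].
  assert (In A (G ++ E)) as HA by (apply in_or_app; right; apply Hi; left; reflexivity).
  apply in_split in HA as [l1 [l2 Hl]].
  assert (Permutation (A :: l1 ++ l2) (G ++ E)) as HP by (rewrite Hl; apply Permutation_middle).
  apply (derivable_perm HP), d_contraction.
  eapply derivable_perm; [|exact H]; simpl; constructor; apply Permutation_sym, HP.
Qed.

Lemma derivable_incl cuts G E C : incl G E -> derivable D cuts G C -> derivable D cuts E C.
Proof.
  intros Hi H; apply (derivable_absorb Hi).
  eapply derivable_perm; [apply Permutation_app_comm|]; apply derivable_app, H.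
Qed.

Ltac solve_incl :=
  unfold incl in *; simpl in *; intros ?;
  repeat first [rewrite in_app_iff | progress simpl]; intuition auto.

Lemma cl_closed (Z : fact) : closed (cl Z).
Proof. intros G H E C HZ; apply H; intros G' HG'; apply HG', HZ. Qed.

Lemma cl_unit (Z : fact) : le Z (cl Z).
Proof. intros G H E C HZ; apply HZ, H. Qed.

Lemma cl_mono (Z W : fact) : le Z W -> le (cl Z) (cl W).
Proof. intros H G HG E C HW; apply HG; auto. Qed.

Lemma closed_upward (X : fact) : closed X -> upward X.
Proof.
  intros HX G G' Hi HG; apply HX; intros E C H.
  eapply derivable_incl; [|apply H, HG]. apply incl_app; [apply incl_appl, Hi|apply incl_appr, incl_refl].
Qed.

Lemma cl_least (Z X : fact) : closed X -> le Z X -> le (cl Z) X.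
Proof. intros HX HZ G HG; apply HX; exact (cl_mono HZ HG). Qed.

(** The semantic form of left rules with a side context: a generator of the closure may be assumed
    at an extension of [G], where everything known at [G] still holds. *)
Lemma cl_bind (Z Y : fact) G : upward Z -> closed Y -> cl Z G ->
  (forall G', incl G G' -> Z G' -> Y G') -> Y G.
Proof.
  intros HZ HY HG H; apply HY; intros E C HC.
  (* One copy of [G] is traded for [G'], the other stays so that the context reached contains [G];
     contraction pays for the duplication. *)
  apply (@derivable_incl false (G ++ G ++ E)); [solve_incl|].
  apply HG; intros G' HG'; rewrite app_assoc; apply HC, H; [solve_incl|].
  eapply HZ; [|exact HG']; solve_incl.
Qed.

Lemma provable_closed A : closed (provable A).
Proof.
  intros G H; unfold provable; rewrite <- (app_nil_r G); apply H.
  intros G' HG'; rewrite app_nil_r; exact HG'.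
Qed.

Lemma provable_conv A A' : conv A A' -> provable A = provable A'.
Proof.
  intros H; apply fact_ext; intros G; apply derivable_conv; [exact H|apply conv_sym, H].
Qed.

Definition meet (X Y : fact) : fact := fun G => X G /\ Y G.
Definition join (X Y : fact) : fact := cl (fun G => X G \/ Y G).
(** Kripke implication with [incl] as the order; since [G'] contains [G], no union of two contexts
    has to be formed. *)
Definition impl (X Y : fact) : fact := fun G => forall G', incl G G' -> X G' -> Y G'.
Definition meets (I : Type) (X : I -> fact) : fact := fun G => forall i, X i G.
Definition joins (I : Type) (X : I -> fact) : fact := cl (fun G => exists i, X i G).

(** * Closure properties of the operations on facts *)

Lemma meet_closed X Y : closed X -> closed Y -> closed (meet X Y).
Proof.
  intros HX HY G H; split; [apply HX|apply HY]; eapply cl_mono; try exact H; intros G' [? ?]; auto.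
Qed.

Lemma meets_closed I (X : I -> fact) : (forall i, closed (X i)) -> closed (meets X).
Proof. intros HX G H i; apply HX; eapply cl_mono; [|exact H]; intros G' HG'; apply HG'. Qed.

Lemma guarded_closed (P : Prop) X : (P -> closed X) -> closed (fun G => P -> X G).
Proof. intros HX G H p; apply (HX p); eapply cl_mono; [|exact H]; intros G' HG'; apply HG', p. Qed.

Lemma impl_closed X Y : upward X -> closed Y -> closed (impl X Y).
Proof.
  intros HX HY G H G' Hi HG'; apply HY; intros E C HC.
  apply (@derivable_incl false (G ++ G' ++ E)); [solve_incl|].
  apply H; intros F HF; rewrite app_assoc; apply HC, HF; [solve_incl|].
  eapply HX; [|exact HG']; solve_incl.
Qed.

Lemma or_upward X Y : upward X -> upward Y -> upward (fun G => X G \/ Y G).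
Proof. intros HX HY G G' Hi [H|H]; [left; eapply HX|right; eapply HY]; eassumption. Qed.

Lemma ex_upward I (X : I -> fact) : (forall i, upward (X i)) -> upward (fun G => exists i, X i G).
Proof. intros HX G G' Hi [i H]; exists i; eapply HX; eassumption. Qed.

(* Okada's condition on the interpretation of a formula *)
Definition adequate (A : gform Sg) (X : fact) : Prop :=
  closed X /\ X [A] /\ le X (provable A).

Lemma adequate_conv A A' X : conv A A' -> adequate A X -> adequate A' X.
Proof.
  intros Hc [H1 [H2 H3]]; split; [exact H1|split].
  - apply H1; intros E C H; apply (derivable_conv_hyp Hc), (H _ H2).
  - rewrite <- (provable_conv Hc); exact H3.
Qed.

(** * Adequacy of connectives and quantifiers *)

Lemma adequate_bot : adequate f_bot (cl (fun _ => False)).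
Proof.
  split; [apply cl_closed|split].
  - intros E C _; apply d_botL.
  - apply cl_least; [apply provable_closed|intros G []].
Qed.

Lemma adequate_top : adequate f_top (fun _ => True).
Proof.
  split; [intros G _; exact I|split; [exact I|]].
  intros G _; apply d_topR.
Qed.

Lemma adequate_and A B X Y : adequate A X -> adequate B Y -> adequate (f_and A B) (meet X Y).
Proof.
  intros [H1 [H2 H3]] [K1 [K2 K3]]; split; [apply meet_closed; assumption|split; [split|]].
  - apply H1; intros E C H; apply d_andL1, (H _ H2).
  - apply K1; intros E C H; apply d_andL2, (H _ K2).
  - intros G [? ?]; apply d_andR; [apply H3|apply K3]; assumption.
Qed.

Lemma adequate_or A B X Y : adequate A X -> adequate B Y -> adequate (f_or A B) (join X Y).
Proof.
  intros [H1 [H2 H3]] [K1 [K2 K3]]; split; [apply cl_closed|split].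
  - intros E C H; apply d_orL; [apply (H [A]); left|apply (H [B]); right]; assumption.
  - apply cl_least; [apply provable_closed|].
    intros G [H|H]; [apply d_orR1, H3, H|apply d_orR2, K3, H].
Qed.

(** The two halves of adequacy change roles on the left of the implication: that members of [X]
    prove [A] gives the premise of the left rule, and [[A]] in [X] serves the right rule. *)
Lemma adequate_imp A B X Y : adequate A X -> adequate B Y -> adequate (f_imp A B) (impl X Y).
Proof.
  intros [H1 [H2 H3]] [K1 [K2 K3]]; split; [|split].
  - apply impl_closed; [apply closed_upward|]; assumption.
  - intros G Hi HG; apply K1; intros E C H.
    apply (@derivable_incl false (f_imp A B :: G ++ E)); [solve_incl|].
    apply d_impL.
    + apply (@derivable_incl false G); [solve_incl|]. apply H3, HG.
    + apply (@derivable_incl false ([B] ++ E)); [solve_incl|]. apply H, K2.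
  - intros G H; apply d_impR, K3, H; [solve_incl|].
    eapply (closed_upward H1); [|exact H2]; solve_incl.
Qed.

Lemma adequate_all a (ha : firstorder a = true) B (X : gtm a -> fact) :
  (forall t, adequate (inst B t) (X t)) -> adequate (f_all ha B) (meets X).
Proof.
  intros H; split; [apply meets_closed; intros t; apply H|split].
  - intros t; destruct (H t) as [H1 [H2 _]]; apply H1; intros E C HC; exact (d_allL _ (HC _ H2)).
  - intros G HG; apply d_allR; intros t; apply H, HG.
Qed.

Lemma adequate_ex a (ha : firstorder a = true) B (X : gtm a -> fact) :
  (forall t, adequate (inst B t) (X t)) -> adequate (f_ex ha B) (joins X).
Proof.
  intros H; split; [apply cl_closed|split].
  - intros E C HC; apply d_exL; intros t; apply (HC [inst B t]); exists t; apply H.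
  - apply cl_least; [apply provable_closed|].
    intros G [t HG]; apply d_exR with t; apply H, HG.
Qed.

(** * Interpretation of terms *)

(* An element of a function type also receives the argument as a closed term,
   which is what atoms depend on; base types carry no further information. *)
Fixpoint dom (a : type Sg) : Type :=
  match a with
  | tbase _ => unit
  | to => fact
  | tarr a b => gtm a -> dom a -> dom b
  end.

(** Quantified variables and predicate arguments are first-order, and a first-order domain has a
    single element, so there this is the value of every term. The choice at [to] is arbitrary. *)
Fixpoint dflt (a : type Sg) : dom a :=
  match a with
  | tbase _ => tt
  | to => fun _ => True
  | tarr _ b => fun _ _ => dflt b
  end.

Definition valuation : Type := forall p : pred Sg, tms [] (parg p) -> fact.

Fixpoint curry (As : list (type Sg)) : (tms [] As -> fact) -> dom (arrs As) :=
  match As with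
  | [] => fun F => F tt
  | a :: As => fun F u _ => curry (fun ts : tms [] As => F (u, ts))
  end.

Fixpoint dapps (As : list (type Sg)) : dom (arrs As) -> tms [] As -> fact :=
  match As with
  | [] => fun x _ => x
  | a :: As => fun x ts => dapps (x (fst ts) (dflt a)) (snd ts)
  end.

Definition eval_const (V : valuation) (a : type Sg) (c : const a) : dom a :=
  match c in const a return dom a with
  | Bot => cl (fun _ => False)
  | Top => fun _ => True
  | And => fun _ X _ Y => meet X Y
  | Or => fun _ X _ Y => join X Y
  | Imp => fun _ X _ Y => impl X Y
  | @All _ a _ => fun _ f => meets (fun t => f t (dflt a))
  | @Ex _ a _ => fun _ f => joins (fun t => f t (dflt a))
  | Fn f => dflt (fn_ty f)
  | Pred p => curry (V p)
  end.

Definition env (G : ctx Sg) : Type := forall a, var G a -> dom a.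

Definition env_cons (G : ctx Sg) (b : type Sg) (x : dom b) (e : env G) : env (b :: G) :=
  fun a y =>
  match y in var G' a' return
    match G' with
    | [] => unit
    | b' :: G0 => dom b' -> (forall a, var G0 a -> dom a) -> dom a'
    end
  with
  | vz => fun x _ => x
  | vs _ y => fun _ e => e _ y
  end x e.

Definition env_nil : env [] := fun a x => False_rect _ (var_nil x).

Definition sub_nil : sub (Sg := Sg) [] [] := fun a x => Var x.

(** A closing substitution accompanies the environment because function values also take the closed
    argument term. *)
Fixpoint eval (V : valuation) (G : ctx Sg) (a : type Sg) (t : tm G a) :
    sub G [] -> env G -> dom a :=
  match t in tm G a return sub G [] -> env G -> dom a with
  | Var x => fun _ e => e _ x
  | Con c => fun _ _ => eval_const V c
  | App t u => fun s e => eval V t s e (subst s u) (eval V u s e)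
  | Lam t => fun s e u x => eval V t (sub_cons u s) (env_cons x e)
  end.

Definition sem (V : valuation) (a : type Sg) (t : gtm a) : dom a := eval V t sub_nil env_nil.

Definition semf (V : valuation) (A : gform Sg) : fact := @sem V to A.

Lemma eval_rename V G a (t : tm G a) : forall E (r : ren G E) s e,
  eval V (rename r t) s e = eval V t (fun a x => s a (r a x)) (fun a x => e a (r a x)).
Proof.
  induction t; intros E r s e; simpl; auto.
  - rewrite IHt1, IHt2, subst_rename; reflexivity.
  - apply functional_extensionality; intros u; apply functional_extensionality; intros x.
    rewrite IHt; f_equal;
      apply fun_var_ext; intros c y; pattern c, y; apply var_cons_case; reflexivity.
Qed.

Lemma eval_shift V G a b (t : tm G a) (u : gtm b) x s e :
  eval V (shift b t) (sub_cons u s) (env_cons x e) = eval V t s e.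
Proof. apply eval_rename. Qed.

Lemma eval_subst V G a (t : tm G a) : forall E (r : sub G E) s e,
  eval V (subst r t) s e =
  eval V t (fun a x => subst s (r a x)) (fun a x => eval V (r a x) s e).
Proof.
  induction t; intros E r s e; simpl; auto.
  - rewrite IHt1, IHt2, subst_subst; reflexivity.
  - apply functional_extensionality; intros u; apply functional_extensionality; intros x.
    rewrite IHt; f_equal;
      apply fun_var_ext; intros c y; pattern c, y; apply var_cons_case; try reflexivity.
    + intros d z; apply subst_shift.
    + intros d z; apply eval_shift.
Qed.

Lemma eval_inst V G a b (t : tm (b :: G) a) (u : tm G b) s e :
  eval V (inst t u) s e = eval V t (sub_cons (subst s u) s) (env_cons (eval V u s e) e).
Proof.
  unfold inst; rewrite eval_subst; f_equal;
    apply fun_var_ext; intros c y; pattern c, y; apply var_cons_case; reflexivity.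
Qed.

Lemma dom_firstorder a : firstorder a = true -> forall x y : dom a, x = y.
Proof.
  induction a; simpl; intros Ha x y; [destruct x, y; reflexivity|discriminate|].
  apply andb_true_iff in Ha as [H1 H2].
  apply functional_extensionality; intros u; apply functional_extensionality; intros z.
  apply IHa2, H2.
Qed.

Lemma sem_inst V a b (ha : firstorder a = true) (B : tm [a] b) (t : gtm a) :
  sem V (inst B t) = eval V B (sub_cons t sub_nil) (env_cons (dflt a) env_nil).
Proof.
  unfold sem; rewrite eval_inst, (dom_firstorder ha _ (dflt a)).
  f_equal; f_equal; apply subst_closed.
Qed.

Lemma semf_all V a (ha : firstorder a = true) B :
  semf V (f_all ha B) = meets (fun t => semf V (inst B t)).
Proof.
  unfold semf; apply fact_ext; intros G H t; specialize (H t); simpl in *;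
    rewrite (sem_inst V ha) in *; exact H.
Qed.

Lemma semf_ex V a (ha : firstorder a = true) B :
  semf V (f_ex ha B) = joins (fun t => semf V (inst B t)).
Proof.
  unfold semf, joins, sem; simpl; unfold joins; f_equal.
  apply functional_extensionality; intros G; apply propositional_extensionality.
  split; intros [t H]; exists t; change (eval V (inst B t) sub_nil env_nil) with (sem V (inst B t)) in *;
    rewrite (sem_inst V ha) in *; exact H.
Qed.

(** * Invariance under conversion *)

Fixpoint tms_conv (As : list (type Sg)) :
    tms [] As -> tms [] As -> Prop :=
  match As with
  | [] => fun _ _ => True
  | a :: As => fun ts us => conv (fst ts) (fst us) /\ tms_conv (snd ts) (snd us)
  end.

Lemma tms_conv_refl As (ts : tms [] As) : tms_conv ts ts.
Proof. induction As; simpl; [exact I|split; [apply conv_refl|apply IHAs]]. Qed.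

Lemma tms_conv_sym As (ts us : tms [] As) : tms_conv ts us -> tms_conv us ts.
Proof.
  induction As; simpl; [trivial|intros [H1 H2]; split; [apply conv_sym, H1|apply IHAs, H2]].
Qed.

Lemma conv_apps As : forall (t u : gtm (arrs As)) (ts us : tms [] As),
  conv t u -> tms_conv ts us -> conv (apps t ts) (apps u us).
Proof.
  induction As as [|a As IH]; simpl; intros t u ts us H H'; [exact H|].
  apply IH; [apply conv_app; [exact H|apply H']|apply H'].
Qed.

Definition respects (V : valuation) : Prop :=
  forall p ts us, tms_conv ts us -> V p ts = V p us.

Section Relation.
Variable K : forall a : type Sg, gtm a -> gtm a -> Prop.
Hypothesis K_firstorder : forall a, firstorder a = true ->
  forall t u : gtm a, K t u <-> conv t u.

(** [K] compares the term components. It is conversion in [crel], and replacement of a predicate in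
    [rrel]; both agree at first-order types, where atoms and quantifiers inspect terms. *)
Fixpoint rel (a : type Sg) : dom a -> dom a -> Prop :=
  match a with
  | tbase _ => fun _ _ => True
  | to => fun X Y => X = Y
  | tarr a b => fun f g => forall t u x y, K t u -> rel x y -> rel (f t x) (g u y)
  end.

Lemma rel_firstorder a : firstorder a = true -> forall x y : dom a, rel x y.
Proof.
  induction a; simpl; intros Ha x y; [exact I|discriminate|].
  apply andb_true_iff in Ha as [H1 H2]; auto.
Qed.

Lemma rel_curry As : all_fo As -> forall F F' : tms [] As -> fact,
  (forall ts us, tms_conv ts us -> F ts = F' us) -> rel (curry F) (curry F').
Proof.
  induction As as [|a As IH]; simpl; intros Hfo F F' H; [apply H, I|].
  intros t u x y Ht _; apply IH; [apply Hfo|].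
  intros ts us Hts; apply H; split; [|exact Hts].
  apply K_firstorder; [apply Hfo|exact Ht].
Qed.

Lemma rel_const (V W : valuation) a (c : const a) :
  match c with
  | Pred p => forall ts us, tms_conv ts us -> V p ts = W p us
  | _ => True
  end ->
  rel (eval_const V c) (eval_const W c).
Proof.
  destruct c; simpl; intros H; auto.
  - intros; congruence.
  - intros; congruence.
  - intros; congruence.
  - intros t u f g Ht Hf; f_equal; apply functional_extensionality; intros v.
    apply Hf; [apply K_firstorder; [exact ha|apply conv_refl]|apply rel_firstorder, ha].
  - intros t u f g Ht Hf; f_equal; apply functional_extensionality; intros v.
    apply Hf; [apply K_firstorder; [exact ha|apply conv_refl]|apply rel_firstorder, ha].
  - apply rel_firstorder, fn_fo.
  - apply rel_curry; [apply parg_fo|exact H].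
Qed.

End Relation.

Definition crel : forall a : type Sg, dom a -> dom a -> Prop := rel (fun a => @conv Sg [] a).

Lemma crel_sym a : forall x y : dom a, crel x y -> crel y x.
Proof.
  induction a; unfold crel; simpl; intros x y H; [exact I|symmetry; exact H|].
  intros t u x' y' Ht Hx; apply IHa2, H; [apply conv_sym, Ht|apply IHa1, Hx].
Qed.

Lemma crel_trans a : forall x y z : dom a, crel x y -> crel y z -> crel x z.
Proof.
  induction a; unfold crel; simpl; intros x y z H H'; [exact I|congruence|].
  intros t u x' y' Ht Hx; eapply IHa2; [apply H; [exact Ht|exact Hx]|].
  apply H'; [apply conv_refl|].
  (* [crel] is only a partial equivalence, so [y'] is related to itself by going back through
     [x']. *)
  eapply IHa1; [apply crel_sym, Hx|exact Hx].
Qed.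

Lemma crel_eval V (HV : respects V) G a (t : tm G a) : forall s s' e e',
  (forall b x, conv (s b x) (s' b x)) -> (forall b x, crel (e b x) (e' b x)) ->
  crel (eval V t s e) (eval V t s' e').
Proof.
  induction t; intros s s' e e' Hs He; simpl.
  - apply He.
  - apply rel_const; [intros; reflexivity|].
    destruct c; trivial; intros ts us H; apply HV, H.
  - apply IHt1; [exact Hs|exact He|apply conv_sub_ext, Hs|apply IHt2; assumption].
  - intros u u' x x' Hu Hx; apply IHt;
      intros c y; pattern c, y; apply var_cons_case; auto.
Qed.

Lemma crel_conv V (HV : respects V) G a (t t' : tm G a) : conv t t' -> forall s s' e e',
  (forall b x, conv (s b x) (s' b x)) -> (forall b x, crel (e b x) (e' b x)) ->
  crel (eval V t s e) (eval V t' s' e').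
Proof.
  induction 1; intros s s' e e' Hs He.
  - apply crel_eval; assumption.
  - apply crel_sym, IHconv; intros; [apply conv_sym, Hs|apply crel_sym, He].
  - eapply crel_trans; [apply IHconv1; eassumption|apply IHconv2; [intros; apply conv_refl|]].
    intros b x; eapply crel_trans; [apply crel_sym|]; apply He.
  - simpl; apply IHconv1; [exact Hs|exact He| |apply IHconv2; assumption].
    eapply conv_trans; [apply conv_subst; eassumption|apply conv_sub_ext, Hs].
  - intros v v' x x' Hv Hx; apply IHconv;
      intros c y; pattern c, y; apply var_cons_case; auto.
  - change (eval V (App (Lam t) u) s e)
      with (eval V t (sub_cons (subst s u) s) (env_cons (eval V u s e) e)).
    rewrite <- eval_inst; apply crel_eval; assumption.
  (* Function types are interpreted by functions, so eta holds by functional extensionality. *)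
  - replace (eval V (Lam (App (shift a t) (Var vz))) s' e') with (eval V t s' e').
    + apply crel_eval; assumption.
    + simpl; apply functional_extensionality; intros u; apply functional_extensionality; intros x.
      rewrite eval_shift; reflexivity.
Qed.

Lemma semf_conv V (HV : respects V) A B : conv A B -> semf V A = semf V B.
Proof.
  intros H; apply (crel_conv HV H); intros b x; [apply conv_refl|destruct (var_nil x)].
Qed.

Lemma tms_conv_trans As (x y z : tms [] As) : tms_conv x y -> tms_conv y z -> tms_conv x z.
Proof.
  induction As; simpl; [trivial|intros [? ?] [? ?]].
  split; [eapply conv_trans; eassumption|eapply IHAs; eassumption].
Qed.

Lemma eval_apps V G As : forall (t : tm G (arrs As)) (ts : tms G As) s e,
  all_fo As ->
  eval V (apps t ts) s e = dapps (eval V t s e) (tms_map (fun a => @subst Sg _ _ a s) ts).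
Proof.
  induction As as [|a As IH]; simpl; intros t ts s e Hfo; [reflexivity|].
  rewrite IH by apply Hfo; simpl.
  rewrite (dom_firstorder (proj1 Hfo) _ (dflt a)); reflexivity.
Qed.

Lemma dapps_curry As : forall (F : tms [] As -> fact) ts, dapps (curry F) ts = F ts.
Proof.
  induction As as [|a As IH]; simpl; intros F ts; [destruct ts; reflexivity|].
  rewrite IH; destruct ts; reflexivity.
Qed.

Lemma tms_map_closed As (s : sub (Sg := Sg) [] []) : forall ts : tms [] As,
  tms_map (fun a => @subst Sg _ _ a s) ts = ts.
Proof.
  induction As as [|a As IH]; simpl; intros []; [reflexivity|].
  simpl; rewrite IH; f_equal; apply subst_closed.
Qed.

Lemma eval_atom V G p (ts : tms G (parg p)) s e :
  eval V (atom p ts) s e = V p (tms_map (fun a => @subst Sg _ _ a s) ts).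
Proof.
  unfold atom; rewrite (@eval_apps V G (parg p)) by apply parg_fo; simpl; apply dapps_curry.
Qed.

Lemma semf_atom V p ts : semf V (atom p ts) = V p ts.
Proof. unfold semf, sem; rewrite eval_atom, tms_map_closed; reflexivity. Qed.

Lemma semf_gapps V p (S : gtm (pty p)) ts : semf V (gapps S ts) = dapps (sem V S : dom (arrs (parg p))) ts.
Proof.
  unfold semf, sem, gapps; rewrite (@eval_apps V [] (parg p)) by apply parg_fo.
  rewrite tms_map_closed; reflexivity.
Qed.

(* A valuation may single out the class of one tuple, so atoms are injective
   modulo conversion. *)
Lemma atom_inj p (ts us : tms [] (parg p)) : conv (atom p ts) (atom p us) -> tms_conv ts us.
Proof.
  intros H.
  set (V := fun q (vs : tms [] (parg q)) (_ : list (gform Sg)) =>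
    exists e : p = q, tms_conv (eq_rect p (fun q => tms [] (parg q)) ts q e) vs).
  assert (respects V) as HV.
  { intros q vs ws Hv; apply functional_extensionality; intros G; apply propositional_extensionality.
    split; intros [e He]; exists e; eapply tms_conv_trans; try eassumption; apply tms_conv_sym, Hv. }
  pose proof (semf_conv HV H) as E; rewrite !semf_atom in E.
  assert (V p ts []) as Hp by (exists eq_refl; apply tms_conv_refl).
  rewrite E in Hp; destruct Hp as [e He].
  rewrite (proof_irrelevance _ e eq_refl) in He; exact He.
Qed.

(** * Interpretation of replacement *)

Section Replace.
Variables (p : pred Sg) (S : gtm (pty p)) (V W : valuation).
Hypothesis HV : respects V.
Hypothesis HVW : forall q ts, p <> q -> @V q ts = @W q ts.

Definition rrel : forall a : type Sg, dom a -> dom a -> Prop :=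
  rel (fun a t u => conv t (replace_pred u S)).

Lemma replace_firstorder a : firstorder a = true ->
  forall t u : gtm a, conv t (replace_pred u S) <-> conv t u.
Proof.
  intros Ha t u; split; intros H; (eapply conv_trans; [exact H|]);
    [|apply conv_sym]; apply conv_replace_firstorder, Ha.
Qed.

(** On the left [p] is replaced in the syntax, on the right the valuation changes at [p]. [P] may be
    open because in a fixed-point operator it is the variable bound for the predicate. *)
Lemma rrel_eval G a (t : tm G a) : forall (P : tm G (pty p)) s s' e e',
  conv (subst s P) S -> rrel (eval V P s e) (curry (@W p) : dom (pty p)) ->
  (forall b x, conv (s b x) (replace_pred (s' b x) S)) ->
  (forall b x, rrel (e b x) (e' b x)) ->
  rrel (eval V (replace_pred t P) s e) (eval W t s' e').
Proof.
  induction t; intros P s s' e e' HP HP' Hs He.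
  - apply He.
  - assert (match c with
      | Pred q => p <> q -> forall ts us, tms_conv ts us -> @V q ts = @W q us
      | _ => True end) as Hc.
    { destruct c; trivial; intros n ts us H; rewrite <- HVW by exact n; apply HV, H. }
    destruct c; try (apply rel_const; [apply replace_firstorder|exact I]).
    simpl; destruct (excluded_middle_informative (p = p0)) as [e0|n].
    + destruct e0; exact HP'.
    + exact (@rel_const _ replace_firstorder V W _ (Pred p0) (Hc n)).
  - apply IHt1; auto.
    + apply conv_subst_replace; assumption.
    + apply IHt2; assumption.
  - intros u u' x x' Hu Hx; apply IHt.
    + rewrite subst_shift; exact HP.
    + rewrite eval_shift; exact HP'.
    + intros c y; pattern c, y; apply var_cons_case; auto.
    + intros c y; pattern c, y; apply var_cons_case; auto.
Qed.

End Replace.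

(** * Interpretation of the fixed-point operators *)

Fixpoint sub_push (As : list (type Sg)) : forall G, tms [] As -> sub G [] -> sub (rev_append As G) [] :=
  match As with
  | [] => fun _ _ s => s
  | a :: As => fun G ts s => @sub_push As (a :: G) (snd ts) (sub_cons (fst ts) s)
  end.

Fixpoint env_push (As : list (type Sg)) : forall G, env G -> env (rev_append As G) :=
  match As with
  | [] => fun _ e => e
  | a :: As => fun G e => @env_push As (a :: G) (env_cons (dflt a) e)
  end.

Arguments sub_push {As G} ts s [a] x.
Arguments env_push As {G} e [a] x.

Lemma dapps_lams V As : forall G (t : tm (rev_append As G) to) s e ts,
  dapps (eval V (@lams _ As G t) s e) ts = eval V t (sub_push ts s) (env_push As e).
Proof.
  induction As as [|a As IH]; simpl; intros G t s e ts; [reflexivity|].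
  apply IH.
Qed.

Lemma sub_push_under As : forall G ts (s : sub G []) a (x : var G a),
  sub_push ts s (var_under As x) = s a x.
Proof. induction As as [|b As IH]; simpl; intros G ts s a x; [reflexivity|rewrite IH; reflexivity]. Qed.

Lemma env_push_under As : forall G (e : env G) a (x : var G a),
  env_push As e (var_under As x) = e a x.
Proof. induction As as [|b As IH]; simpl; intros G e a x; [reflexivity|rewrite IH; reflexivity]. Qed.

Lemma lams_vars_push As : forall G ts (s : sub G []),
  tms_map (fun a => @subst Sg _ _ a (sub_push ts s)) (lams_vars As G) = ts.
Proof.
  induction As as [|b As IH]; simpl; intros G ts s; [destruct ts; reflexivity|].
  rewrite IH, sub_push_under; destruct ts; reflexivity.
Qed.

Fixpoint sub_app (X : ctx Sg) : forall G, sub X [] -> sub G [] -> sub (X ++ G) [] :=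
  match X with
  | [] => fun _ _ s => s
  | a :: X => fun G r s => sub_cons (r a vz) (sub_app (fun b x => r b (vs a x)) s)
  end.

Fixpoint env_app (X : ctx Sg) : forall G, env G -> env (X ++ G) :=
  match X with
  | [] => fun _ e => e
  | a :: X => fun G e => env_cons (dflt a) (@env_app X G e)
  end.

Arguments sub_app {X G} r s [a] x.
Arguments env_app X {G} e [a] x.

Lemma sub_app_r X : forall G r (s : sub G []) a (x : var G a), sub_app r s (var_r X x) = s a x.
Proof. induction X; simpl; intros; [reflexivity|apply IHX]. Qed.

Lemma env_app_r X : forall G (e : env G) a (x : var G a), env_app X e (var_r X x) = e a x.
Proof. induction X; simpl; intros; [reflexivity|apply IHX]. Qed.

Lemma sub_app_l X : forall G (r : sub X []) (s : sub G []) a (x : var X a),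
  sub_app r s (var_l G x) = r a x.
Proof.
  intros G r s a x; induction x as [X a|X a b x IH]; simpl; [reflexivity|].
  apply (IH (fun b0 x => r b0 (vs b x))).
Qed.

Lemma eval_exs_intro V X : forall G (h : all_fo X) (B : tm (X ++ G) to) r s e,
  le (eval V B (sub_app r s) (env_app X e)) (eval V (exs h B) s e).
Proof.
  induction X as [|a X IH]; simpl; intros G h B r s e F HF; [exact HF|].
  apply (IH G (proj2 h) _ (fun b x => r b (vs a x))).
  apply cl_unit; exists (r a vz); exact HF.
Qed.

Lemma eval_exs_elim V X : forall G (h : all_fo X) (B : tm (X ++ G) to) s e Y,
  closed Y -> (forall r, le (eval V B (sub_app r s) (env_app X e)) Y) ->
  le (eval V (exs h B) s e) Y.
Proof.
  induction X as [|a X IH]; simpl; intros G h B s e Y HY H; [apply (H (fun a x => False_rect _ (var_nil x)))|].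
  apply IH; [exact HY|]; intros r; apply cl_least; [exact HY|].
  intros F [t HF]; apply (H (sub_cons t r)); exact HF.
Qed.

Lemma eval_disj_intro V G (Bs : list (tm G to)) B s e :
  In B Bs -> le (eval V B s e) (eval V (disj Bs) s e).
Proof.
  induction Bs as [|A Bs IH]; intros HB; [destruct HB|].
  destruct Bs as [|A' Bs].
  - destruct HB as [->|[]]; intros F HF; exact HF.
  - intros F HF; destruct HB as [->|HB]; apply cl_unit; [left; exact HF|right; exact (IH HB F HF)].
Qed.

Lemma eval_disj_elim V G (Bs : list (tm G to)) s e Y :
  closed Y -> (forall B, In B Bs -> le (eval V B s e) Y) -> le (eval V (disj Bs) s e) Y.
Proof.
  intros HY; induction Bs as [|A Bs IH]; intros H.
  - apply cl_least; [exact HY|intros F []].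
  - destruct Bs as [|A' Bs]; [apply H; left; reflexivity|].
    apply cl_least; [exact HY|]; intros F [HF|HF].
    + apply (H A); [left; reflexivity|exact HF].
    + apply IH; [intros B HB; apply H; right; exact HB|exact HF].
Qed.

(** An equation holds at every context or is contained in every closed fact, so under [eqs_and] it
    acts as a side condition of the metalanguage. *)
Definition equality_valuation (V : valuation) : Prop :=
  forall a (ha : firstorder a = true) (t u : gtm a),
    (conv t u -> forall G, V (EqP ha) (t, (u, tt)) G) /\
    (forall Y, closed Y -> (conv t u -> False) -> le (V (EqP ha) (t, (u, tt))) Y).

Lemma eval_eqs_intro V (HE : equality_valuation V) G As : forall (h : all_fo As) (xs ts : tms G As) (B : tm G to) s e,
  tms_conv (tms_map (fun a => @subst Sg _ _ a s) xs) (tms_map (fun a => @subst _ _ _ a s) ts) ->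
  le (eval V B s e) (eval V (eqs_and h xs ts B) s e).
Proof.
  induction As as [|a As IH]; simpl; intros h xs ts B s e H F HF; [exact HF|]; split.
  - change (eval V (f_eq (proj1 h) (fst xs) (fst ts)) s e F); unfold f_eq; rewrite eval_atom.
    apply (HE a (proj1 h)), H.
  - apply IH; [apply H|exact HF].
Qed.

Lemma eval_eqs_elim V (HE : equality_valuation V) G As : forall (h : all_fo As) (xs ts : tms G As) (B : tm G to) s e Y,
  closed Y ->
  (tms_conv (tms_map (fun a => @subst Sg _ _ a s) xs) (tms_map (fun a => @subst _ _ _ a s) ts) ->
   le (eval V B s e) Y) ->
  le (eval V (eqs_and h xs ts B) s e) Y.
Proof.
  induction As as [|a As IH]; simpl; intros h xs ts B s e Y HY H; [apply H, I|].
  intros F [HF1 HF2].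
  change (eval V (f_eq (proj1 h) (fst xs) (fst ts)) s e F) in HF1.
  unfold f_eq in HF1; rewrite eval_atom in HF1.
  destruct (excluded_middle_informative (conv (subst s (fst xs)) (subst s (fst ts)))) as [Hc|Hc].
  - revert F HF1 HF2; intros F _; revert F; apply IH; [exact HY|].
    intros Hcs; apply H; split; assumption.
  - exact (proj2 (HE a (proj1 h) _ _) Y HY Hc F HF1).
Qed.

(** A predicate value may be rebuilt from its term arguments alone, because its semantic arguments
    are first-order and carry nothing. *)
Lemma rel_curry_dapps K (HK : forall a : type Sg, firstorder a = true -> forall t u : gtm a, K a t u <-> conv t u)
    As : all_fo As -> forall x y : dom (arrs As), crel x y -> rel K x (curry (dapps y)).
Proof.
  induction As as [|a As IH]; simpl; intros Hfo x y H; [exact H|].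
  intros t u z z' Ht _; apply IH; [apply Hfo|]; apply H.
  - apply HK; [apply Hfo|exact Ht].
  - apply rel_firstorder, Hfo.
Qed.

Lemma var_firstorder (X : ctx Sg) a (x : var X a) : all_fo X -> firstorder a = true.
Proof. induction x; simpl; intros [? ?]; auto. Qed.

(** * Pointwise relations along extended substitutions and environments *)

Lemma sub_app_ind (P : forall a : type Sg, gtm a -> gtm a -> Prop) X : forall G (r : sub X []) (s s' : sub G []),
  (forall a x, P a (r a x) (r a x)) -> (forall a x, P a (s a x) (s' a x)) ->
  forall a x, P a (sub_app r s x) (sub_app (a := a) r s' x).
Proof.
  induction X as [|b X IH]; simpl; intros G r s s' Hr Hs; [exact Hs|].
  intros a x; pattern a, x; apply var_cons_case; [apply Hr|].
  exact (IH G _ s s' (fun a x => Hr a (vs b x)) Hs).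
Qed.

Lemma env_app_ind (P : forall a : type Sg, dom a -> dom a -> Prop) X :
  (forall a, firstorder a = true -> P a (dflt a) (dflt a)) -> all_fo X ->
  forall G (e e' : env G), (forall a x, P a (e a x) (e' a x)) ->
  forall a x, P a (env_app X e x) (env_app X (a := a) e' x).
Proof.
  intros HP; induction X as [|b X IH]; simpl; intros Hfo G e e' He; [exact He|].
  intros a x; pattern a, x; apply var_cons_case; [apply HP, Hfo|].
  exact (IH (proj2 Hfo) G e e' He).
Qed.

Lemma sub_push_ind (P : forall a : type Sg, gtm a -> gtm a -> Prop) As :
  (forall a, firstorder a = true -> forall t, P a t t) -> all_fo As ->
  forall G (ts : tms [] As) (s s' : sub G []), (forall a x, P a (s a x) (s' a x)) ->
  forall a x, P a (sub_push ts s x) (sub_push (a := a) ts s' x).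
Proof.
  intros HP; induction As as [|b As IH]; simpl; intros Hfo G ts s s' Hs; [exact Hs|].
  apply IH; [apply Hfo|].
  intros a x; pattern a, x; apply var_cons_case; [apply HP, Hfo|exact Hs].
Qed.

Lemma env_push_ind (P : forall a : type Sg, dom a -> dom a -> Prop) As :
  (forall a, firstorder a = true -> P a (dflt a) (dflt a)) -> all_fo As ->
  forall G (e e' : env G), (forall a x, P a (e a x) (e' a x)) ->
  forall a x, P a (env_push As e x) (env_push As (a := a) e' x).
Proof.
  intros HP; induction As as [|b As IH]; simpl; intros Hfo G e e' He; [exact He|].
  apply IH; [apply Hfo|].
  intros a x; pattern a, x; apply var_cons_case; [apply HP, Hfo|exact He].
Qed.

Lemma tms_map_map G E F (f : forall a : type Sg, tm G a -> tm E a) (g : forall a, tm E a -> tm F a) As :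
  forall ts : tms G As, tms_map g (tms_map f ts) = tms_map (fun a t => g a (f a t)) ts.
Proof. induction As as [|a As IH]; simpl; intros ts; [reflexivity|rewrite IH; reflexivity]. Qed.

Lemma tms_map_ext G E (f g : forall a : type Sg, tm G a -> tm E a) As :
  (forall a t, f a t = g a t) -> forall ts : tms G As, tms_map f ts = tms_map g ts.
Proof. intros H; induction As as [|a As IH]; simpl; intros ts; [reflexivity|rewrite IH, H; reflexivity]. Qed.

Lemma subst_apps G E As : forall (t : tm G (arrs As)) ts (s : sub G E),
  subst s (apps t ts) = apps (subst s t) (tms_map (fun a => @subst Sg G E a s) ts).
Proof. induction As as [|a As IH]; simpl; intros t ts s; [reflexivity|rewrite IH; reflexivity]. Qed.

Lemma clause_head_eq p (c : clause p) (s : sub (cl_ctx c) []) :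
  clause_head s = atom p (tms_map (fun a => @subst Sg _ _ a s) (cl_args c)).
Proof. unfold clause_head, atom; rewrite (@subst_apps _ _ (parg p)); reflexivity. Qed.

(** The immediate-consequence operator, for both kinds of predicates at once; [semf_fix_op] links it
    to the fixed-point operators. *)
Definition Phi (V : valuation) : valuation := fun p ts =>
  cl (fun G => exists (c : clause p) (s : sub (cl_ctx c) []),
    has_clause D c /\ conv (clause_head s) (atom p ts) /\ semf V (clause_inst s) G).

Lemma semf_closed V (HV : respects V) (HC : forall p ts, closed (V p ts)) A : closed (semf V A).
Proof.
  induction (gform_formula A) as [A B Hc _ IH| | |A B _ IHA _ IHB|A B _ IHA _ IHB|A B _ IHA _ IHB
    |a ha B _ IH|a ha B _ IH|p ts].
  - rewrite <- (semf_conv HV Hc); exact IH.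
  - apply cl_closed.
  - intros G _; exact I.
  - apply meet_closed; assumption.
  - apply cl_closed.
  - apply impl_closed; [apply closed_upward|]; assumption.
  - rewrite semf_all; apply meets_closed, IH.
  - rewrite semf_ex; apply cl_closed.
  - rewrite semf_atom; apply HC.
Qed.

Section FixOp.
Variables (p : pred Sg) (S : gtm (pty p)) (V W : valuation).
Hypothesis HV : respects V.
Hypothesis HC : forall q ts, closed (@V q ts).
Hypothesis HE : equality_valuation V.
Hypothesis HVW : forall q ts, p <> q -> @V q ts = @W q ts.
Hypothesis HWp : forall ts, @W p ts = dapps (sem V S : dom (arrs (parg p))) ts.

Lemma eval_clause_body (c : clause p) (r : sub (cl_ctx c) []) ts :
  eval V (replace_pred (p := p) (rename (fun b x => var_l _ x) (cl_body c))
    (Var (var_r (cl_ctx c) (var_under (parg p) (vz : var [pty p] (pty p))))))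
    (sub_app r (sub_push ts (sub_cons S sub_nil)))
    (env_app (cl_ctx c) (env_push (parg p) (env_cons (sem V S) env_nil))) =
  semf W (clause_inst r).
Proof.
  pose proof (cl_fo c) as Hfo.
  assert (rel (fun a t u => conv t (replace_pred u S)) (sem V S)
    (curry (@W p) : dom (pty p))) as HS.
  { replace (@W p) with (dapps (sem V S : dom (arrs (parg p)))).
    - apply (rel_curry_dapps (replace_firstorder S)); [apply parg_fo|].
      apply (crel_eval HV); intros b x; destruct (var_nil x).
    - apply functional_extensionality; intros us; symmetry; apply HWp. }
  (* In the middle term the variable for the predicate is sent to the constant [p], whose
     replacement by [S] is [S]; the body itself does not use that variable. *)
  transitivity (eval W (rename (fun b x => var_l _ x) (cl_body c))
    (sub_app r (sub_push ts (sub_cons (Con (Pred p)) sub_nil)))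
    (env_app (cl_ctx c) (env_push (parg p) (env_cons (curry (@W p) : dom (pty p)) env_nil)))).
  - refine (@rrel_eval p S V W HV HVW _ to _ _ _ _ _ _ _ _ _ _).
    + simpl; rewrite sub_app_r, sub_push_under; apply conv_refl.
    + simpl; rewrite env_app_r, env_push_under; exact HS.
    + apply (sub_app_ind (P := fun a t u => conv t (replace_pred u S))).
      * intros a x; apply conv_sym, conv_replace_firstorder, (var_firstorder x Hfo).
      * apply (sub_push_ind (P := fun a t u => conv t (replace_pred u S)));
          [intros a ha t; apply conv_sym, conv_replace_firstorder, ha|apply parg_fo|].
        intros a x; pattern a, x; apply var_cons_case; [|intros b y; destruct (var_nil y)].
        simpl sub_cons; rewrite replace_Pred; apply conv_refl.
    + apply (env_app_ind (P := rrel S)); [intros a ha; apply rel_firstorder, ha|exact Hfo|].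
      apply (env_push_ind (P := rrel S)); [intros a ha; apply rel_firstorder, ha|apply parg_fo|].
      intros a x; pattern a, x; apply var_cons_case; [exact HS|intros b y; destruct (var_nil y)].
  - unfold semf, sem, clause_inst; rewrite eval_rename, eval_subst; f_equal;
      apply fun_var_ext; intros a x.
    + rewrite sub_app_l; symmetry; apply subst_closed.
    + apply dom_firstorder, (var_firstorder x Hfo).
Qed.

(** Disjunction, existentials and equations amount to the choice of a clause and a substitution
    whose head matches the atom; the match is read off by [atom_inj]. *)
Lemma semf_fix_op cs ts : def_of D p = IndPred cs ->
  semf V (gapps (App (fix_op cs) S) ts) = Phi W ts.
Proof.
  intros Hcs.
  assert (forall c : clause p, has_clause D c <-> In c cs) as Hin.
  { intros c; unfold has_clause; rewrite Hcs; reflexivity. }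
  (* Recorded before the formula is unfolded; the second inclusion needs the closedness of the
     unfolded value. *)
  pose proof (@semf_closed V HV HC (gapps (App (fix_op cs) S) ts)) as Hcl; revert Hcl.
  rewrite semf_gapps; simpl sem; unfold sem; simpl eval.
  assert (subst sub_nil S = S) as -> by apply subst_closed.
  rewrite (@dapps_lams V (parg p) [pty p]); intros Hcl.
  assert (forall (c : clause p) (r : sub (cl_ctx c) []) (us : tms [] (parg p)),
    tms_map (fun a => @subst Sg _ _ a (sub_app r (sub_push us (sub_cons S sub_nil))))
      (tms_map (fun a => rename (fun b x => var_r (cl_ctx c) x)) (lams_vars (parg p) [pty p])) = us)
    as Hxs.
  { intros c r us; rewrite tms_map_map; etransitivity; [|apply (lams_vars_push us (sub_cons S sub_nil))].
    apply tms_map_ext; intros a t; rewrite subst_rename; f_equal.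
    apply fun_var_ext; intros b x; apply sub_app_r. }
  assert (forall (c : clause p) (r : sub (cl_ctx c) []) (us : tms [] (parg p)),
    tms_map (fun a => @subst Sg _ _ a (sub_app r (sub_push us (sub_cons S sub_nil))))
      (tms_map (fun a => rename (fun b x => var_l _ x)) (cl_args c)) =
    tms_map (fun a => @subst Sg _ _ a r) (cl_args c)) as Hts.
  { intros c r us; rewrite tms_map_map; apply tms_map_ext; intros a t; rewrite subst_rename; f_equal.
    apply fun_var_ext; intros b x; apply sub_app_l. }
  apply fact_ext.
  - apply eval_disj_elim; [apply cl_closed|]; intros B HB.
    apply in_map_iff in HB as [c [<- Hc]].
    apply eval_exs_elim; [apply cl_closed|]; intros r.
    apply (eval_eqs_elim HE); [apply cl_closed|]; rewrite Hxs, Hts; intros Hconv F HF.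
    apply cl_unit; exists c, r; split; [apply Hin, Hc|split].
    + rewrite clause_head_eq; apply (conv_apps (As := parg p)); [apply conv_refl|].
      apply tms_conv_sym, Hconv.
    + rewrite <- (eval_clause_body r ts); exact HF.
  - apply cl_least; [exact Hcl|]; intros F [c [r [Hc [Hhead HF]]]].
    apply (@eval_disj_intro V _ _ (clause_disjunct c)); [apply in_map, Hin, Hc|].
    apply (@eval_exs_intro V (cl_ctx c) _ (cl_fo c) _ r), (eval_eqs_intro HE).
    + rewrite Hxs, Hts; apply tms_conv_sym, atom_inj; rewrite <- clause_head_eq; exact Hhead.
    + rewrite <- (eval_clause_body r ts) in HF; exact HF.
Qed.

End FixOp.

(** * Operator of the definition *)

Lemma Phi_closed V p ts : closed (Phi V (p := p) ts).
Proof. apply cl_closed. Qed.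

Lemma Phi_respects V : respects (Phi V).
Proof.
  assert (forall p (ts us : tms [] (parg p)), tms_conv ts us -> le (Phi V ts) (Phi V us)) as H.
  { intros p ts us Hc; apply cl_mono; intros G [c [s [H1 [H2 H3]]]]; exists c, s.
    split; [exact H1|split; [|exact H3]].
    eapply conv_trans; [exact H2|apply (conv_apps (As := parg p)); [apply conv_refl|exact Hc]]. }
  intros p ts us Hc; apply fact_ext; apply H; [exact Hc|apply tms_conv_sym, Hc].
Qed.

Definition eq_fact (a : type Sg) (t u : gtm a) : fact := cl (fun _ => conv t u).

(** The only clause has body top, so the value does not depend on [V]. *)
Lemma Phi_eq V a (ha : firstorder a = true) (t u : gtm a) :
  Phi V (p := EqP ha) (t, (u, tt)) = eq_fact t u.
Proof.
  assert (forall s : sub [a] [], clause_head (c := eq_clause ha) s =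
    @atom Sg [] (EqP ha) (s a vz, (s a vz, tt))) as Hh by reflexivity.
  apply fact_ext; apply cl_mono; intros G.
  - intros [c [s [Hc [Hconv _]]]].
    unfold has_clause in Hc; simpl in Hc; subst c.
    rewrite Hh in Hconv; destruct (atom_inj Hconv) as [H1 [H2 _]]; simpl in H1, H2.
    eapply conv_trans; [apply conv_sym, H1|exact H2].
  - intros H; exists (eq_clause ha), (sub_cons t sub_nil); split; [reflexivity|split; [|exact I]].
    rewrite Hh; apply (conv_apps (As := [a; a])); [apply conv_refl|].
    split; [apply conv_refl|split; [exact H|exact I]].
Qed.

Lemma adequate_eq a (ha : firstorder a = true) (t u : gtm a) :
  adequate (@atom Sg [] (EqP ha) (t, (u, tt))) (eq_fact t u).
Proof.
  split; [apply cl_closed|split].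
  - intros E C H.
    eapply (@d_defL Sg D false E (EqP ha) _ (t, (u, tt)) C); [reflexivity|].
    intros c s Hc Hconv; simpl in Hc; subst c.
    (* The generator of [eq_fact] ignores its context, so the empty one may be taken; if the terms
       are not convertible, no premise arises. *)
    apply d_weakening, (H []).
    destruct (atom_inj (p := EqP ha) (ts := (s a vz, (s a vz, tt))) Hconv) as [H1 [H2 _]]; simpl in H1, H2.
    eapply conv_trans; [apply conv_sym, H1|exact H2].
  - apply cl_least; [apply provable_closed|]; intros G H.
    eapply (@d_defR Sg D false G (EqP ha) _ (t, (u, tt)) (eq_clause ha) (sub_cons t sub_nil));
      [reflexivity|reflexivity| |apply d_topR].
    apply (conv_apps (As := [a; a])
      (ts := (t, (t, tt))) (us := (t, (u, tt)))); [apply conv_refl|].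
    split; [apply conv_refl|split; [exact H|exact I]].
Qed.

Lemma eq_fact_valuation V :
  (forall a (ha : firstorder a = true) (t u : gtm a), V (EqP ha) (t, (u, tt)) = eq_fact t u) ->
  equality_valuation V.
Proof.
  intros H a ha t u; rewrite H; split.
  - intros Hc G; apply cl_unit, Hc.
  - intros Y HY Hc; apply cl_least; [exact HY|]; intros G HG; destruct (Hc HG).
Qed.

Lemma semf_adequate V (HV : respects V) :
  (forall p ts, adequate (atom p ts) (V p ts)) -> forall A, adequate A (semf V A).
Proof.
  intros H A.
  induction (gform_formula A) as [A B Hc _ IH| | |A B _ IHA _ IHB|A B _ IHA _ IHB|A B _ IHA _ IHB
    |a ha B _ IH|a ha B _ IH|p ts].
  - rewrite <- (semf_conv HV Hc); apply (adequate_conv Hc), IH.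
  - apply adequate_bot.
  - apply adequate_top.
  - apply adequate_and; assumption.
  - apply adequate_or; assumption.
  - apply adequate_imp; assumption.
  - rewrite semf_all; apply adequate_all, IH.
  - rewrite semf_ex; apply adequate_ex, IH.
  - rewrite semf_atom; apply H.
Qed.

(** Adequacy of bodies passes to heads by the right rules. For an inductive predicate [Phi V] is
    first recognised as the meaning of the operator applied to [p] itself. *)
Lemma clause_adequate V (HV : respects V) (HA : forall p ts, adequate (atom p ts) (V p ts))
    (HE : equality_valuation V) p ts :
  le (Phi V (p := p) ts) (provable (atom p ts)).
Proof.
  destruct (def_of D p) as [cs|cs] eqn:Hp.
  - apply cl_least; [apply provable_closed|]; intros G [c [s [Hc [Hconv HG]]]].
    unfold has_clause in Hc; rewrite Hp in Hc.
    eapply d_defR; [exact Hp|exact Hc|exact Hconv|].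
    apply (semf_adequate HV HA), HG.
  - rewrite <- (@semf_fix_op p (Con (Pred p)) V V HV (fun q us => proj1 (HA q us)) HE
      (fun q us _ => eq_refl) (fun us => eq_sym (@dapps_curry (parg p) (V p) us)) cs ts Hp).
    intros G HG; apply (d_muR Hp), (semf_adequate HV HA), HG.
Qed.

(** * Changing a valuation at one predicate *)

Definition update (p : pred Sg) (F : tms [] (parg p) -> fact) (V : valuation) : valuation :=
  fun q us =>
  match excluded_middle_informative (p = q) with
  | left e => eq_rect p (fun q => tms [] (parg q) -> fact) F q e us
  | right _ => V q us
  end.

Lemma update_same (p : pred Sg) (F : tms [] (parg p) -> fact) V us : update F V us = F us :> fact.
Proof.
  unfold update; destruct (excluded_middle_informative (p = p)) as [e|n]; [|destruct n; reflexivity].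
  rewrite (proof_irrelevance _ e eq_refl); reflexivity.
Qed.

Lemma update_other (p : pred Sg) (F : tms [] (parg p) -> fact) V q us : p <> q -> update (p := p) F V us = V q us.
Proof.
  intros H; unfold update; destruct (excluded_middle_informative (p = q)); [contradiction|reflexivity].
Qed.

Lemma update_case (p : pred Sg) (F : tms [] (parg p) -> fact) V (P : forall q, tms [] (parg q) -> fact -> Prop) :
  (forall us, P p us (F us)) -> (forall q us, p <> q -> P q us (V q us)) ->
  forall q us, P q us (update (p := p) F V us).
Proof.
  intros H1 H2 q us; destruct (excluded_middle_informative (p = q)) as [e|n].
  - destruct e; rewrite update_same; apply H1.
  - rewrite (update_other _ _ _ n); apply H2, n.
Qed.

Lemma update_respects (p : pred Sg) (F : tms [] (parg p) -> fact) V : respects V ->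
  (forall ts us, tms_conv ts us -> F ts = F us) -> respects (update (p := p) F V).
Proof.
  intros HV HF q ts us H; destruct (excluded_middle_informative (p = q)) as [e|n].
  - destruct e; rewrite !update_same; apply HF, H.
  - rewrite !(update_other _ _ _ n); apply HV, H.
Qed.

(** * The model *)

Section Model.
Variable lvl : gform Sg -> ord.
Hypothesis Hlvl : level_assignment lvl.
Hypothesis Hclause : forall (p : pred Sg) (c : clause p) (s : sub (cl_ctx c) []),
  has_clause D c -> ole (lvl (clause_inst s)) (lvl (clause_head s)).
Hypothesis Hind : forall (p : pred Sg) cs, def_of D p = IndPred cs ->
  forall ts us : tms [] (parg p), oeq (lvl (atom p ts)) (lvl (atom p us)).

(** The two claims need each other: the antecedent of an implication of level at most [l] lies
    strictly below [l], where the valuations coincide, so contravariance does no harm. *)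
Lemma semf_mono l V W (HV : respects V) (HW : respects W) :
  (forall p ts, ole (lvl (atom p ts)) l -> le (V p ts) (W p ts)) ->
  (forall p ts, olt (lvl (atom p ts)) l -> V p ts = W p ts) ->
  forall A, (ole (lvl A) l -> le (semf V A) (semf W A)) /\
            (olt (lvl A) l -> semf V A = semf W A).
Proof.
  intros Hle Heq A.
  induction (gform_formula A) as [A B Hc _ IH| | |A B _ IHA _ IHB|A B _ IHA _ IHB|A B _ IHA _ IHB
    |a ha B _ IH|a ha B _ IH|p ts].
  - rewrite <- (semf_conv HV Hc), <- (semf_conv HW Hc).
    pose proof (proj1 (lvl_conv Hlvl Hc)) as Hl.
    split; intros H; apply IH; [eapply ole_trans|eapply ole_olt_trans]; eassumption.
  - split; intros _; [intros G HG; exact HG|reflexivity].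
  - split; intros _; [intros G HG; exact HG|reflexivity].
  - assert (ole (lvl A) (lvl (f_and A B)) /\ ole (lvl B) (lvl (f_and A B))) as [LA LB].
    { split; (eapply ole_trans; [|apply (lvl_and Hlvl)]); [apply ole_omax_l|apply ole_omax_r]. }
    split; intros H.
    + intros G [HA HB]; split; [apply IHA|apply IHB]; try assumption; eapply ole_trans; eassumption.
    + change (meet (semf V A) (semf V B) = meet (semf W A) (semf W B)).
      f_equal; [apply IHA|apply IHB]; eapply ole_olt_trans; eassumption.
  - assert (ole (lvl A) (lvl (f_or A B)) /\ ole (lvl B) (lvl (f_or A B))) as [LA LB].
    { split; (eapply ole_trans; [|apply (lvl_or Hlvl)]); [apply ole_omax_l|apply ole_omax_r]. }
    split; intros H.
    + apply cl_mono; intros G [HA|HB]; [left; apply IHA|right; apply IHB];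
        try assumption; eapply ole_trans; eassumption.
    + change (join (semf V A) (semf V B) = join (semf W A) (semf W B)).
      f_equal; [apply IHA|apply IHB]; eapply ole_olt_trans; eassumption.
  - assert (olt (lvl A) (lvl (f_imp A B)) /\ ole (lvl B) (lvl (f_imp A B))) as [LA LB].
    { split; (eapply ole_trans; [|apply (lvl_imp Hlvl)]); [apply ole_omax_l|apply ole_omax_r]. }
    assert (ole (lvl (f_imp A B)) l -> semf V A = semf W A) as EA.
    { intros H; apply IHA; eapply olt_ole_trans; eassumption. }
    split; intros H.
    + intros G HG G' Hi HA.
      change (semf W A G') in HA; rewrite <- EA in HA by exact H.
      apply IHB; [eapply ole_trans; eassumption|]; exact (HG G' Hi HA).
    + change (impl (semf V A) (semf V B) = impl (semf W A) (semf W B)).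
      f_equal; [|apply IHB; eapply ole_olt_trans; eassumption].
      apply IHA; eapply olt_ole_trans; [exact LA|].
      eapply ole_trans; [|exact H]; apply ole_osucc.
  - assert (forall t, ole (lvl (inst B t)) (lvl (f_all ha B))) as LB.
    { intros t; eapply ole_trans; [|apply (lvl_all Hlvl)].
      apply (ole_olub (fun t => lvl (inst B t))). }
    rewrite !semf_all; split; intros H.
    + intros G HG t; apply IH; [eapply ole_trans; [apply LB|exact H]|apply HG].
    + f_equal; apply functional_extensionality; intros t; apply IH.
      eapply ole_olt_trans; [apply LB|exact H].
  - assert (forall t, ole (lvl (inst B t)) (lvl (f_ex ha B))) as LB.
    { intros t; eapply ole_trans; [|apply (lvl_ex Hlvl)].
      apply (ole_olub (fun t => lvl (inst B t))). }
    rewrite !semf_ex; split; intros H.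
    + apply cl_mono; intros G [t HG]; exists t; apply IH; [eapply ole_trans; [apply LB|exact H]|apply HG].
    + f_equal; apply functional_extensionality; intros t; apply IH.
      eapply ole_olt_trans; [apply LB|exact H].
  - rewrite !semf_atom; split; intros H; [apply Hle|apply Heq]; exact H.
Qed.

Lemma Phi_mono V W (HV : respects V) (HW : respects W) p (ts : tms [] (parg p)) :
  (forall q us, ole (lvl (atom q us)) (lvl (atom p ts)) -> le (V q us) (W q us)) ->
  (forall q us, olt (lvl (atom q us)) (lvl (atom p ts)) -> V q us = W q us) ->
  le (Phi V ts) (Phi W ts).
Proof.
  intros Hle Heq; apply cl_mono; intros G [c [s [Hc [Hconv HG]]]].
  exists c, s; split; [exact Hc|split; [exact Hconv|]].
  apply (semf_mono HV HW Hle Heq); [|exact HG].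
  eapply ole_trans; [apply Hclause, Hc|apply (lvl_conv Hlvl Hconv)].
Qed.

Lemma Phi_local V W (HV : respects V) (HW : respects W) p (ts : tms [] (parg p)) :
  (forall q us, ole (lvl (atom q us)) (lvl (atom p ts)) -> V q us = W q us) ->
  Phi V ts = Phi W ts.
Proof.
  intros H; apply fact_ext; apply Phi_mono; try assumption; intros q us Hq.
  - rewrite (H q us Hq); intros G HG; exact HG.
  - apply H, ole_osucc_ole, Hq.
  - rewrite (H q us Hq); intros G HG; exact HG.
  - symmetry; apply H, ole_osucc_ole, Hq.
Qed.

(** Only the prefixed-point condition is bounded by [l], since clauses of atoms up to [l] never
    consult atoms above it. *)
Definition admissible (l : ord) (X : valuation) : Prop :=
  respects X /\ (forall p ts, closed (X p ts)) /\ (forall p ts, X p ts [atom p ts]) /\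
  (forall p ts, ole (lvl (atom p ts)) l -> le (Phi X (p := p) ts) (X p ts)).

(* The least fixed point of [Phi] among the atoms of level [l], with the
   interpretation of the atoms of smaller level given. *)
Definition model_step (l : ord) (V : forall l', olt l' l -> valuation) : valuation :=
  fun p ts G => forall X, admissible l X ->
    (forall q us (h : olt (lvl (atom q us)) l), X q us = V _ h q us) -> X p ts G.

Definition model : valuation := fun p ts => Fix olt_wf (fun _ => valuation) model_step (lvl (atom p ts)) p ts.

Definition candidate (l : ord) (X : valuation) : Prop :=
  admissible l X /\ forall q us, olt (lvl (atom q us)) l -> X q us = model us.

Definition stage (l : ord) : valuation := fun p ts G => forall X, candidate l X -> X p ts G.

Lemma model_eq p ts : model (p := p) ts = stage (lvl (atom p ts)) ts.
Proof.
  unfold model at 1; rewrite Fix_eq.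
  - apply functional_extensionality; intros G; apply propositional_extensionality; split.
    + intros H X [H1 H2]; apply H; assumption.
    + intros H X H1 H2; apply H; split; assumption.
  - intros l V W H; replace W with V; [reflexivity|].
    apply functional_extensionality_dep; intros l'; apply functional_extensionality; intros h; apply H.
Qed.

Lemma candidate_oeq l l' X : oeq l l' -> candidate l X -> candidate l' X.
Proof.
  intros [H H'] [[H1 [H2 [H3 H4]]] H5]; split; [split; [exact H1|split; [exact H2|split; [exact H3|]]]|].
  - intros p ts Hp; apply H4; eapply ole_trans; eassumption.
  - intros p ts Hp; apply H5; eapply olt_ole_trans; eassumption.
Qed.

(** Conversion preserves levels only up to [oeq], so a stage must not depend on the representative
    of its ordinal. *)
Lemma stage_oeq l l' : oeq l l' -> stage l = stage l'.
Proof.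
  assert (forall l l' p ts, oeq l l' -> le (stage l (p := p) ts) (stage l' ts)) as H.
  { intros k k' p ts Hk G HG X HX; apply HG; eapply candidate_oeq; [|exact HX].
    split; apply Hk. }
  intros Hl; apply functional_extensionality_dep; intros p; apply functional_extensionality; intros ts.
  apply fact_ext; apply H; [exact Hl|split; apply Hl].
Qed.

Lemma stage_respects l : respects (stage l).
Proof.
  intros p ts us H; apply fact_ext; intros G HG X HX.
  - rewrite <- (proj1 (proj1 HX) p ts us H); apply HG, HX.
  - rewrite (proj1 (proj1 HX) p ts us H); apply HG, HX.
Qed.

Lemma lvl_atom p ts us : tms_conv ts us -> oeq (lvl (atom p ts)) (lvl (atom p us)).
Proof. intros H; apply (lvl_conv Hlvl), (conv_apps (As := parg p)); [apply conv_refl|exact H]. Qed.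

Lemma model_respects : respects model.
Proof.
  intros p ts us H; rewrite !model_eq, (stage_oeq (lvl_atom H)); apply stage_respects, H.
Qed.

(** What the construction does not give at once: adequacy, the right rules, and left unfolding for
    fixed-point predicates. The left rule of inductive predicates rests on [model_induction]. *)
Definition good (p : pred Sg) (ts : tms [] (parg p)) : Prop :=
  le (model ts) (provable (atom p ts)) /\ le (Phi model ts) (model ts) /\
  (forall cs, def_of D p = FixPred cs -> le (model ts) (Phi model ts)).

Lemma stage_closed l p ts : closed (stage l (p := p) ts).
Proof.
  intros G HG X HX; apply (proj1 (proj2 (proj1 HX))); eapply cl_mono; [|exact HG].
  intros F HF; apply HF, HX.
Qed.

Lemma stage_refl l p ts : stage l ts [atom p ts].
Proof. intros X HX; apply (proj1 (proj2 (proj2 (proj1 HX)))). Qed.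

Lemma model_adequate p ts : good ts -> adequate (atom p ts) (model ts).
Proof.
  intros H; split; [|split; [|apply H]]; rewrite model_eq; [apply stage_closed|apply stage_refl].
Qed.

Lemma good_eq a (ha : firstorder a = true) (t u : gtm a) :
  good (p := EqP ha) (t, (u, tt)) -> model (p := EqP ha) (t, (u, tt)) = eq_fact t u.
Proof.
  intros [_ [H1 H2]]; specialize (H2 _ eq_refl); rewrite Phi_eq in H1, H2; apply fact_ext; assumption.
Qed.

(** * One level, with all smaller levels already good *)

Section Level.
Variable l : ord.
Hypothesis IH : forall p ts, olt (lvl (atom p ts)) l -> good (p := p) ts.

(* The greatest candidate. *)
Definition upper : valuation := fun p =>
  match p return tms [] (parg p) -> fact with
  | @EqP _ a ha => fun ts => eq_fact (fst ts) (fst (snd ts))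
  | UserP q => fun ts =>
      if excluded_middle_informative (olt (lvl (atom (UserP q) ts)) l)
      then model (p := UserP q) ts else provable (atom (UserP q) ts)
  end.

Lemma upper_below p ts : olt (lvl (atom p ts)) l -> upper ts = model ts.
Proof.
  intros H; destruct p as [a ha|q].
  - destruct ts as [t [u []]]; symmetry; apply good_eq, IH, H.
  - simpl; destruct (excluded_middle_informative _); [reflexivity|contradiction].
Qed.

Lemma upper_adequate p ts : adequate (atom p ts) (upper ts).
Proof.
  destruct p as [a ha|q].
  - destruct ts as [t [u []]]; apply adequate_eq.
  - simpl; destruct (excluded_middle_informative _) as [H|H]; [apply model_adequate, IH, H|].
    split; [apply provable_closed|split; [apply d_axiom|intros G HG; exact HG]].
Qed.

Lemma upper_respects : respects upper.
Proof.
  intros p ts us H; destruct p as [a ha|q].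
  - destruct ts as [t [u []]], us as [t' [u' []]], H as [Ht [Hu _]]; simpl in *.
    unfold eq_fact; f_equal; apply functional_extensionality; intros _.
    apply propositional_extensionality; split; intros H.
    + eapply conv_trans; [apply conv_sym, Ht|eapply conv_trans; [exact H|exact Hu]].
    + eapply conv_trans; [exact Ht|eapply conv_trans; [exact H|apply conv_sym, Hu]].
  - pose proof (lvl_atom (p := UserP q) H) as [H1 H2]; simpl.
    destruct (excluded_middle_informative (olt (lvl (atom (UserP q) ts)) l)) as [Hl|Hl];
      destruct (excluded_middle_informative (olt (lvl (atom (UserP q) us)) l)) as [Hl'|Hl'].
    + apply model_respects, H.
    + destruct Hl'; eapply ole_olt_trans; eassumption.
    + destruct Hl; eapply ole_olt_trans; eassumption.
    + apply provable_conv, (conv_apps (As := pr_args q)); [apply conv_refl|exact H].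
Qed.

(** Below [l] it inherits prefixedness from [model]; at [l] provability is closed under the clauses.
    Since it is adequate, it makes the least candidate adequate. *)
Lemma upper_candidate : candidate l upper.
Proof.
  split; [|apply upper_below].
  split; [apply upper_respects|split; [|split]].
  - intros p ts; apply upper_adequate.
  - intros p ts; apply upper_adequate.
  - intros p ts Hl; destruct (excluded_middle_informative (olt (lvl (atom p ts)) l)) as [H|H].
    + rewrite (upper_below H).
      rewrite (Phi_local upper_respects model_respects (p := p) (ts := ts)); [apply IH, H|].
      intros q us Hq; apply upper_below; eapply ole_olt_trans; eassumption.
    + destruct p as [a ha|q].
      * destruct ts as [t [u []]]; rewrite Phi_eq; intros G HG; exact HG.
      * simpl; destruct (excluded_middle_informative _); [contradiction|].
        (* Equality atoms may have any level, yet the operators in [clause_adequate] need them read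
           as conversion; hence the separate equality case of [upper]. *)
        apply (clause_adequate upper_respects upper_adequate), eq_fact_valuation; reflexivity.
Qed.

(** The existence of a candidate matters: over an empty family [stage] would contain every
    context. *)
Lemma stage_below p ts : olt (lvl (atom p ts)) l -> stage l ts = model ts.
Proof.
  intros H; apply fact_ext.
  - rewrite <- (upper_below H); intros G HG; apply HG, upper_candidate.
  - intros G HG X HX; rewrite (proj2 HX _ _ H); exact HG.
Qed.

Lemma stage_model p ts : ole (lvl (atom p ts)) l -> stage l ts = model ts.
Proof.
  intros H; destruct (ole_or_olt l (lvl (atom p ts))) as [H'|H']; [|apply stage_below, H'].
  rewrite model_eq, (stage_oeq (conj H H')); reflexivity.
Qed.

(** Knaster-Tarski: an intersection of prefixed points is one, as all candidates agree below [l],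
    where the negative occurrences are. *)
Lemma stage_candidate : candidate l (stage l).
Proof.
  split; [|intros p ts; apply stage_below].
  split; [apply stage_respects|split; [apply stage_closed|split; [apply stage_refl|]]].
  intros p ts Hl G HG X HX; apply HX; [exact Hl|].
  eapply Phi_mono; [apply stage_respects|apply HX| | |exact HG].
  - intros q us _ F HF; apply HF, HX.
  - intros q us Hq; rewrite (proj2 HX); [apply stage_below|]; eapply olt_ole_trans; eassumption.
Qed.

Lemma stage_adequate p ts : adequate (atom p ts) (stage l ts).
Proof.
  split; [apply stage_closed|split; [apply stage_refl|]].
  intros G HG; apply upper_adequate, HG, upper_candidate.
Qed.

Lemma Phi_stage p ts : ole (lvl (atom p ts)) l -> Phi (stage l) (p := p) ts = Phi model ts.
Proof.
  intros H; apply Phi_local; [apply stage_respects|apply model_respects|].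
  intros q us Hq; apply stage_model; eapply ole_trans; eassumption.
Qed.

(** The left rule [d_defL] says exactly this; it keeps [[A]] in the shrunken valuation of
    [good_at]. *)
Lemma Phi_refl V (HV : respects V) : (forall q us, adequate (atom q us) (V q us)) ->
  forall p ts cs, def_of D p = FixPred cs -> Phi V ts [atom p ts].
Proof.
  intros HA p ts cs Hp E C H; apply (d_defL Hp); intros c s Hc Hconv.
  apply (H [clause_inst s]); exists c, s; split; [|split; [exact Hconv|apply (semf_adequate HV HA)]].
  unfold has_clause; rewrite Hp; exact Hc.
Qed.

(* Shrinking [stage l] at the fixed-point atoms of level [l] to their unfoldings
   yields another candidate. *)
Lemma good_at p ts : oeq (lvl (atom p ts)) l -> good (p := p) ts.
Proof.
  intros Hl; pose proof stage_candidate as Hst.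
  unfold good; rewrite <- Phi_stage, <- stage_model by apply Hl; split; [|split].
  - apply stage_adequate.
  - apply Hst, Hl.
  - intros cs Hp.
    set (Q := fun q us => ole l (lvl (atom q us)) /\ exists cs, def_of D q = FixPred cs).
    set (X := fun q us G => stage l (p := q) us G /\ (Q q us -> Phi (stage l) us G)).
    assert (forall q us, le (X q us) (stage l us)) as Hle by (intros q us G HG; apply HG).
    assert (forall q us, olt (lvl (atom q us)) l -> X q us = stage l us) as Hbelow.
    { intros q us Hq; apply fact_ext; [apply Hle|]; intros G HG; split; [exact HG|].
      intros [HQ [cs' Hcs]]; destruct (olt_irrefl (ole_olt_trans HQ Hq)). }
    assert (respects X) as HX.
    { intros q us vs H; pose proof (lvl_atom (p := q) H) as [L1 L2].
      assert (Q q us <-> Q q vs) as HQ.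
      { split; intros [Hq Hcs]; (split; [eapply ole_trans; eassumption|exact Hcs]). }
      apply fact_ext; intros G [H1 H2]; split; try (intros HQ'; apply HQ in HQ'; apply H2 in HQ').
      - rewrite <- (stage_respects l H); exact H1.
      - rewrite <- (Phi_respects (stage l) H); exact HQ'.
      - rewrite (stage_respects l H); exact H1.
      - rewrite (Phi_respects (stage l) H); exact HQ'. }
    assert (candidate l X) as Hcand.
    { split; [split; [exact HX|split; [|split]]|].
      - intros q us; apply meet_closed; [apply stage_closed|].
        apply guarded_closed; intros _; apply Phi_closed.
      - intros q us; split; [apply stage_refl|]; intros [_ [cs' Hcs]].
        apply (Phi_refl (stage_respects l) stage_adequate Hcs).
      - intros q us Hq G HG.
        (* [X] lies inside the stage and agrees with it below [l], so its unfoldings lie inside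
           those of the stage. *)
        assert (Phi (stage l) us G) as HG'.
        { eapply Phi_mono; [exact HX|apply stage_respects| | |exact HG].
          - intros r vs _; apply Hle.
          - intros r vs Hr; apply Hbelow; eapply olt_ole_trans; eassumption. }
        split; [|intros _; exact HG'].
        apply Hst; assumption.
      - intros q us Hq; rewrite (Hbelow q us Hq); apply stage_below, Hq. }
    intros G HG; apply (HG X Hcand); split; [apply Hl|exists cs; exact Hp].
Qed.

End Level.

Lemma model_good p ts : good (p := p) ts.
Proof.
  remember (lvl (atom p ts)) as l eqn:E; revert p ts E.
  induction (olt_wf l) as [l _ IH]; intros p ts E.
  apply (@good_at l); [|rewrite E; split; apply ole_refl].
  intros q us H; exact (IH _ H q us eq_refl).
Qed.

Lemma model_atom_adequate p ts : adequate (atom p ts) (model ts).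
Proof. apply model_adequate, model_good. Qed.

Lemma model_equality : equality_valuation model.
Proof. apply eq_fact_valuation; intros; apply good_eq, model_good. Qed.

Lemma model_semf_adequate A : adequate A (semf model A).
Proof. apply (semf_adequate model_respects model_atom_adequate). Qed.

(** Cutting the stage down to [F] at [p] gives another candidate, and the stage is the least one. *)
Lemma model_induction p cs (Hp : def_of D p = IndPred cs) (F : tms [] (parg p) -> fact) :
  (forall ts us, tms_conv ts us -> F ts = F us) -> (forall ts, closed (F ts)) ->
  (forall ts, F ts [atom p ts]) ->
  (forall ts, le (Phi (update F model) ts) (F ts)) ->
  forall ts, le (model ts) (F ts).
Proof.
  intros HF1 HF2 HF3 HF4 ts.
  set (l := lvl (atom p ts)).
  assert (forall q us, olt (lvl (atom q us)) l -> good (p := q) us) as IH by (intros; apply model_good).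
  pose proof (stage_candidate IH) as Hst.
  set (X := fun q us => meet (stage l (p := q) us) (update F (stage l) us)).
  assert (forall q us, le (X q us) (stage l us)) as Hle by (intros q us G HG; apply HG).
  assert (forall q us, p <> q -> X q us = stage l us) as Hother.
  { intros q us Hq; apply fact_ext; [apply Hle|]; intros G HG; split; [exact HG|].
    rewrite (update_other _ _ _ Hq); exact HG. }
  (* All atoms of the inductive [p] have level [l] up to [oeq], so a change at [p] keeps the
     agreement with [model] below [l]. *)
  assert (forall q us, olt (lvl (atom q us)) l -> p <> q) as Hneq.
  { intros q us Hq e; destruct e.
    apply (olt_irrefl (olt_ole_trans Hq (proj1 (Hind Hp ts us)))). }
  assert (respects X) as HX.
  { intros q us vs H; unfold X; f_equal; [apply stage_respects, H|].
    apply update_respects; [apply stage_respects|exact HF1|exact H]. }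
  assert (candidate l X) as Hcand.
  { split; [split; [exact HX|split; [|split]]|].
    - intros q us; apply meet_closed; [apply stage_closed|].
      apply (update_case (P := fun q us Y => closed Y)); [exact HF2|intros; apply stage_closed].
    - intros q us; split; [apply stage_refl|].
      apply (update_case (P := fun q us Y => Y [atom q us])); [exact HF3|intros; apply stage_refl].
    - intros q us Hq G HG; split.
      + apply Hst; [exact Hq|].
        eapply Phi_mono; [exact HX|apply stage_respects| | |exact HG].
        * intros r vs _; apply Hle.
        * intros r vs Hr; apply Hother, (Hneq r vs); eapply olt_ole_trans; eassumption.
      + destruct (excluded_middle_informative (p = q)) as [e|n].
        * destruct e; rewrite update_same; apply HF4.
          (* At [p] only the component [F] of [X] is kept; elsewhere, up to level [l], the stage is
             [model]. *)
          eapply Phi_mono; [exact HX|apply update_respects; [apply model_respects|exact HF1]| | |exact HG].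
          -- intros r vs Hr; apply (update_case (P := fun r vs Y => ole (lvl (atom r vs)) l -> le (X r vs) Y)).
             ++ intros ws _ H [_ HG']; rewrite update_same in HG'; exact HG'.
             ++ intros r' ws _ Hws; rewrite <- (stage_model IH Hws); apply Hle.
             ++ eapply ole_trans; eassumption.
          -- intros r vs Hr.
             assert (olt (lvl (atom r vs)) l) as Hr' by (eapply olt_ole_trans; eassumption).
             rewrite (Hother r vs (Hneq _ _ Hr')), (update_other _ _ _ (Hneq _ _ Hr')).
             apply stage_below; assumption.
        * rewrite (update_other _ _ _ n); apply Hst; [exact Hq|].
          eapply Phi_mono; [exact HX|apply stage_respects| | |exact HG].
          -- intros r vs _; apply Hle.
          -- intros r vs Hr; apply Hother, (Hneq r vs); eapply olt_ole_trans; eassumption.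
    - intros q us Hq; rewrite (Hother q us (Hneq q us Hq)); apply (stage_below IH), Hq. }
  intros G HG; rewrite model_eq in HG; destruct (HG X Hcand) as [_ H].
  rewrite update_same in H; exact H.
Qed.

Lemma semf_model_closed A : closed (semf model A).
Proof. apply model_semf_adequate. Qed.

Lemma semf_model_upward A : upward (semf model A).
Proof. apply closed_upward, semf_model_closed. Qed.

(** * Soundness *)

(** All hypotheses are read at one context [E], which makes the structural rules trivial and turns
    multicut into composition. *)
Lemma soundness cuts G C : derivable D cuts G C ->
  forall E, (forall A, In A G -> semf model A E) -> semf model C E.
Proof.
  pose proof (semf_conv model_respects) as Hconv.
  induction 1 as [G G' C C' Hs Hc _ IH|p ts|G cs C _ _ IHcs _ IH|G A C _ IH|G A C _ IH|G C|G
    |G A B C _ IH|G A B C _ IH|G A B _ IHA _ IHB|G A B C _ IHA _ IHB|G A B _ IH|G A B _ IH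
    |G A B C _ IHA _ IHB|G A B _ IH|G a ha B t C _ IH|G a ha B _ IH|G a ha B C _ IH|G a ha B t _ IH
    |G p cs ts C Hp _ IH|G p cs ts c s Hp Hc Hh _ IH|G p cs S us C Hp _ IHS _ IH|G p cs ts Hp _ IH];
    intros E HE.
  - rewrite <- (Hconv _ _ Hc); apply IH; intros A HA.
    destruct Hs as [G'' [HP HF]].
    apply (Permutation_in _ HP) in HA.
    assert (exists A', In A' G' /\ conv A A') as [A' [HA' HAA']].
    { clear - HF HA; induction HF as [|x y l l' Hxy HF IH]; [destruct HA|].
      destruct HA as [->|HA]; [exists y; split; [left; reflexivity|exact Hxy]|].
      destruct (IH HA) as [z [Hz1 Hz2]]; exists z; split; [right; exact Hz1|exact Hz2]. }
    rewrite (Hconv _ _ HAA'); apply HE, HA'.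
  - apply HE; left; reflexivity.
  - apply IH; intros A HA; apply in_app_iff in HA as [HA|HA].
    + apply HE, in_or_app; left; exact HA.
    + apply in_map_iff in HA as [DA [<- HDA]]; apply (IHcs _ HDA); intros A HA.
      apply HE, in_or_app; right; apply in_concat; exists (fst DA); split; [apply in_map, HDA|exact HA].
  - apply IH; intros B HB; apply HE; right; exact HB.
  - apply IH; intros B [<-|HB]; apply HE; [left; reflexivity|exact HB].
  - apply (cl_least (@semf_model_closed C) (Z := fun _ => False)); [intros F []|].
    apply (HE f_bot); left; reflexivity.
  - exact I.
  - apply IH; intros X [<-|HX]; [|apply HE; right; exact HX].
    apply (HE (f_and A B)); left; reflexivity.
  - apply IH; intros X [<-|HX]; [|apply HE; right; exact HX].
    apply (HE (f_and A B)); left; reflexivity.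
  - split; [apply IHA|apply IHB]; exact HE.
  - apply (cl_bind (Z := fun F => semf model A F \/ semf model B F)); [|apply semf_model_closed| |].
    + apply or_upward; apply semf_model_upward.
    + apply (HE (f_or A B)); left; reflexivity.
    + intros F HF [HA|HB]; [apply IHA|apply IHB]; intros X [<-|HX]; trivial;
        (eapply semf_model_upward; [exact HF|apply HE; right; exact HX]).
  - apply cl_unit; left; apply IH, HE.
  - apply cl_unit; right; apply IH, HE.
  - apply IHB; intros X [<-|HX]; [|apply HE; right; exact HX].
    assert (semf model (f_imp A B) E) as H by (apply HE; left; reflexivity).
    apply (H E); [apply incl_refl|]; apply IHA; intros X HX; apply HE; right; exact HX.
  - intros F HF HA; apply IH; intros X [<-|HX]; [exact HA|].
    eapply semf_model_upward; [exact HF|apply HE, HX].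
  - apply IH; intros X [<-|HX]; [|apply HE; right; exact HX].
    assert (semf model (f_all ha B) E) as H by (apply HE; left; reflexivity).
    rewrite semf_all in H; apply H.
  - rewrite semf_all; intros t; apply IH, HE.
  - assert (semf model (f_ex ha B) E) as H by (apply HE; left; reflexivity).
    rewrite semf_ex in H.
    eapply cl_bind; [|apply semf_model_closed|exact H|].
    + apply ex_upward; intros t; apply semf_model_upward.
    + intros F HF [t Ht]; apply (IH t); intros X [<-|HX]; [exact Ht|].
      eapply semf_model_upward; [exact HF|apply HE; right; exact HX].
  - rewrite semf_ex; apply cl_unit; exists t; apply IH, HE.
  - assert (semf model (atom p ts) E) as H by (apply HE; left; reflexivity).
    rewrite semf_atom in H; apply (proj2 (proj2 (model_good ts)) _ Hp) in H.
    eapply cl_bind; [|apply semf_model_closed|exact H|].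
    + intros F F' HF [c [s [H1 [H2 H3]]]]; exists c, s; split; [exact H1|split; [exact H2|]].
      eapply semf_model_upward; eassumption.
    + intros F HF [c [s [H1 [H2 H3]]]].
      unfold has_clause in H1; rewrite Hp in H1.
      apply (IH c s H1 H2); intros X [<-|HX]; [exact H3|].
      eapply semf_model_upward; [exact HF|apply HE; right; exact HX].
  - rewrite semf_atom; apply model_good, cl_unit.
    exists c, s; split; [unfold has_clause; rewrite Hp; exact Hc|split; [exact Hh|apply IH, HE]].
  - apply IH; intros X [<-|HX]; [|apply HE; right; exact HX].
    assert (semf model (atom p us) E) as H by (apply HE; left; reflexivity).
    rewrite semf_atom in H.
    assert (forall ts, le (semf model (gapps (App (fix_op cs) S) ts)) (semf model (gapps S ts))) as HS.
    { intros ts F HF; apply IHS; intros X [<-|[]]; exact HF. }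
    assert (forall ts, semf model (gapps S ts) [atom p ts]) as Hrefl.
    { intros ts; apply semf_model_closed; intros F B HB.
      apply (@d_muL Sg D false F p cs S ts B Hp).
      - intros vs; apply model_semf_adequate, HS, model_semf_adequate.
      - apply (HB [gapps S ts]), model_semf_adequate. }
    eapply (model_induction Hp (F := fun ts => semf model (gapps S ts))); [| |exact Hrefl| |exact H].
    + intros ts vs Hts; apply Hconv, (conv_apps (As := parg p)); [apply conv_refl|exact Hts].
    + intros ts; apply semf_model_closed.
    + intros ts.
      (* Unfolding the clauses with [p] read as [S] gives the meaning of [B S ts], which [HS]
         bounds. *)
      rewrite <- (@semf_fix_op p S model (update (fun ts => semf model (gapps S ts)) model)
        model_respects (fun q vs => proj1 (model_atom_adequate vs)) model_equality
        (fun q vs n => eq_sym (update_other _ _ _ n))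
        (fun vs => eq_trans (update_same _ _ vs) (semf_gapps model S vs)) cs ts Hp).
      apply HS.
  - rewrite semf_atom; apply model_good.
    (* With [p] in place of [S] nothing is reinterpreted, and the operator denotes [Phi model]. *)
    rewrite <- (@semf_fix_op p (Con (Pred p)) model model model_respects
      (fun q us => proj1 (model_atom_adequate us)) model_equality
      (fun q us _ => eq_refl) (fun us => eq_sym (@dapps_curry (parg p) (@model p) us)) cs ts Hp).
    apply IH, HE.
Qed.

Lemma cut_admissible cuts G C : derivable D cuts G C -> derivable D false G C.
Proof.
  intros H; apply model_semf_adequate, (soundness H); intros A HA.
  eapply semf_model_upward; [|apply model_semf_adequate].
  intros B [<-|[]]; exact HA.
Qed.

End Model.
End Facts.

Theorem mainTheorem2 (Sg : signature) (D : definition Sg) (HD : stratified D)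
    (G : list (gform Sg)) (C : gform Sg) :
  derivable D true G C -> derivable D false G C.
Proof.
  destruct HD as [lvl [H1 [H2 H3]]]; exact (@cut_admissible Sg D lvl H1 H2 H3 true G C).
Qed.
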